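(* Let $(\mathscr{G},\omega)$ be a Cartan geometry of type $(G,H)$ and $\mathscr{e}\in\mathscr{G}$. The development map $(\cdot)_G\colon\mathrm{Path}_{\mathscr{e}}(\mathscr{G})\to\mathrm{Path}_e(G)$ given by $\gamma\mapsto\gamma_G$ is continuous, where both path spaces carry the first-order compact-open topology.
   Context: A model $(G,H)$ is a Lie group $G$ with a closed subgroup $H$ such that $G/H$ is connected; $e\in G$ is the identity and $\omega_G$ is the (left-invariant) Maurer--Cartan form. A Cartan geometry of type $(G,H)$ over a smooth manifold $M$ is a principal (right) $H$-bundle $\mathscr{G}\to M$ with a $\mathfrak{g}$-valued one-form $\omega$ such that each $\omega_{\mathscr{g}}\colon T_{\mathscr{g}}\mathscr{G}\to\mathfrak{g}$ is a linear isomorphism, $R_h^*\omega=\mathrm{Ad}_{h^{-1}}\omega$ for $h\in H$, and for $Y\in\mathfrak{h}$ the flow of $\omega^{-1}(Y)$ is $t\mapsto R_{\exp(tY)}$. $(G,\omega_G)$ is itself a Cartan geometry of type $(G,H)$ over $G/H$. ''Path'' means piecewise smooth path. $\mathrm{Path}_{\mathscr{e}}(\mathscr{G})$ is the set of paths $\gamma\colon[0,1]\to\mathscr{G}$ with $\gamma(0)=\mathscr{e}$. The development of $\gamma$ is the unique path $\gamma_G\colon[0,1]\to G$ with $\gamma_G(0)=e$ and $\gamma^*\omega=\gamma_G^*\omega_G$. For an inner product $\mathrm{g}$ on $\mathfrak{g}$, the $\omega$-constant Riemannian metric on $\mathscr{G}$ is $\mathrm{g}_\omega(\xi_1,\xi_2)=\mathrm{g}(\omega(\xi_1),\omega(\xi_2))$.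 The first-order compact-open topology on $\mathrm{Path}_{\mathscr{e}}(\mathscr{G})$ is the one induced by the metric $$d_{\mathrm{g}_\omega}(\gamma_1,\gamma_2)=\sup_{t\in[0,1]}\mathrm{dist}_{\mathrm{g}_\omega}(\gamma_1(t),\gamma_2(t))+\sup_{t}\|\omega(\dot\gamma_1(t))-\omega(\dot\gamma_2(t))\|_{\mathrm{g}},$$ the second supremum being over all $t\in[0,1]$ at which both derivatives are well defined; the choice of $\mathrm{g}$ is arbitrary. *)

(* Defs.v *)
From HB Require Import structures.
From mathcomp Require Import all_boot all_order all_algebra generic_quotient.
From mathcomp Require Import all_classical all_reals all_analysis.

Set Implicit Arguments.
Unset Strict Implicit.
Unset Printing Implicit Defensive.

Import Order.TTheory GRing.Theory Num.Theory.
Import numFieldNormedType.Exports.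

Local Open Scope classical_set_scope.
Local Open Scope ring_scope.

(** * Smooth functions between normed spaces *)

Section Smooth.
Context {R : realType}.

(* [iter_derive [:: v1; ..; vk] f] is D_v1 (D_v2 (.. (D_vk f))). *)
Definition iter_derive (E F : normedModType R) (vs : seq E) (f : E -> F) :
    E -> F :=
  foldr (fun v (g : E -> F) (x : E) => 'D_v g x) f vs.

(* C^oo on an open set A of a finite-dimensional E: every iterated directional
   derivative exists and is differentiable at every point of A. *)
Definition smooth_on (E F : normedModType R) (A : set E) (f : E -> F) : Prop :=
  forall (vs : seq E) (x : E), A x -> differentiable (iter_derive vs f) x.

End Smooth.

(** * Charted spaces, smooth maps, smooth manifolds *)

(* [chart_to] and [chart_from] are total functions; they are only meaningful on
   [chart_dom] and [chart_cod], between which they are inverse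
   homeomorphisms. *)
Record chart (R : realType) (T : topologicalType) (E : normedModType R) := Chart {
  chart_dom : set T;
  chart_cod : set E;
  chart_to : T -> E;
  chart_from : E -> T;
  chart_dom_open : open chart_dom;
  chart_cod_open : open chart_cod;
  chart_to_cod : forall x, chart_dom x -> chart_cod (chart_to x);
  chart_from_dom : forall u, chart_cod u -> chart_dom (chart_from u);
  chart_toK : forall x, chart_dom x -> chart_from (chart_to x) = x;
  chart_fromK : forall u, chart_cod u -> chart_to (chart_from u) = u;
  chart_to_continuous : forall x, chart_dom x -> {for x, continuous chart_to};
  chart_from_continuous :
    forall u, chart_cod u -> {for u, continuous chart_from} }.

(* The atlas is indexed by points: it consists of one preferred chart
   [chart_at x] around each point x.  The tangent space at x is represented by
   the model space E, a vector being identified with its coordinates in the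
   preferred chart at x. *)
Record charted_space (R : realType) (E : normedModType R) := ChartedSpace {
  cs_carrier :> topologicalType;
  chart_at : cs_carrier -> chart cs_carrier E;
  mem_chart_at : forall x, chart_dom (chart_at x) x }.

Section NormedCharted.
Context {R : realType} (E : normedModType R).

Program Definition id_chart : chart E E :=
  @Chart R E E setT setT id id openT openT _ _ _ _ _ _.
Next Obligation. by []. Qed.
Next Obligation. by []. Qed.
Next Obligation. by []. Qed.
Next Obligation. by []. Qed.
Next Obligation. by move=> x _; exact: cvg_id. Qed.
Next Obligation. by move=> x _; exact: cvg_id. Qed.

Program Definition normed_cs : charted_space E :=
  @ChartedSpace R E E (fun=> id_chart) _.
Next Obligation. by []. Qed.

End NormedCharted.

Lemma open_setX (T U : topologicalType) (A : set T) (B : set U) :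
  open A -> open B -> open (A `*` B).
Proof.
move=> oA oB; rewrite (_ : A `*` B = fst @^-1` A `&` snd @^-1` B) //.
by apply: openI; apply: open_comp => // x _; [exact: cvg_fst|exact: cvg_snd].
Qed.

Section ProdCharted.
Context {R : realType} {E F : normedModType R}.

Program Definition prod_chart (T U : topologicalType)
    (p : chart T E) (q : chart U F) : chart (T * U)%type (E * F)%type :=
  @Chart R (T * U)%type (E * F)%type
    (chart_dom p `*` chart_dom q) (chart_cod p `*` chart_cod q)
    (fun x => (chart_to p x.1, chart_to q x.2))
    (fun u => (chart_from p u.1, chart_from q u.2)) _ _ _ _ _ _ _ _.
Next Obligation. by move=> T U p q; apply: open_setX; exact: chart_dom_open. Qed.
Next Obligation. by move=> T U p q; apply: open_setX; exact: chart_cod_open. Qed.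
Next Obligation.
by move=> T U p q x [/= ? ?]; split; exact: chart_to_cod.
Qed.
Next Obligation.
by move=> T U p q x [/= ? ?]; split; exact: chart_from_dom.
Qed.
Next Obligation. by move=> T U p q [x y] [/= ? ?]; rewrite !chart_toK. Qed.
Next Obligation. by move=> T U p q [x y] [/= ? ?]; rewrite !chart_fromK. Qed.
Next Obligation.
move=> T U p q [x y] [/= px qy]; apply: cvg_pair => /=.
- by apply: (cvg_comp fst (chart_to p) cvg_fst); exact: chart_to_continuous.
- by apply: (cvg_comp snd (chart_to q) cvg_snd); exact: chart_to_continuous.
Qed.
Next Obligation.
move=> T U p q [x y] [/= px qy]; apply: cvg_pair => /=.
- by apply: (cvg_comp fst (chart_from p) cvg_fst); exact: chart_from_continuous.
- by apply: (cvg_comp snd (chart_from q) cvg_snd); exact: chart_from_continuous.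
Qed.

Program Definition prod_cs (M : charted_space E) (N : charted_space F) :
    charted_space (E * F)%type :=
  @ChartedSpace R (E * F)%type (M * N)%type
    (fun x => prod_chart (chart_at x.1) (chart_at x.2)) _.
Next Obligation. by move=> M N [x y]; split; exact: mem_chart_at. Qed.

End ProdCharted.

Section SmoothMaps.
Context {R : realType} {E F : normedModType R}.
Variables (M : charted_space E) (N : charted_space F).

(* f read in the charts at x and at y, and the set on which this reading makes
   sense when f is restricted to W *)
Definition in_charts (f : M -> N) (x : M) (y : N) : E -> F :=
  chart_to (chart_at y) \o f \o chart_from (chart_at x).

Definition in_charts_dom (W : set M) (f : M -> N) (x : M) (y : N) : set E :=
  [set u | [/\ chart_cod (chart_at x) u, W (chart_from (chart_at x) u) &
               chart_dom (chart_at y) (f (chart_from (chart_at x) u))]].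

(* smoothness on an open set W *)
Definition open_smooth (W : set M) (f : M -> N) : Prop :=
  (forall x, W x -> {for x, continuous f}) /\
  (forall x y, smooth_on (in_charts_dom W f x y) (in_charts f x y)).

Definition smooth_map (f : M -> N) : Prop := open_smooth setT f.

(* Smoothness on an arbitrary subset S: locally the restriction of a smooth map
   defined on an open set.  When S is an embedded submanifold, such as
   P x H in P x G, this is smoothness for its submanifold structure. *)
Definition smooth_within (S : set M) (f : M -> N) : Prop :=
  forall x, S x -> exists (W : set M) (g : M -> N),
    [/\ open W, W x, open_smooth W g & forall y, W y -> S y -> g y = f y].

(* the tangent map of f at x, in the coordinates of the preferred charts *)
Definition differential (f : M -> N) (x : M) : E -> F :=
  'd (in_charts f x (f x)) (chart_to (chart_at x) x).

End SmoothMaps.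

Record manifold (R : realType) (n : nat) := Manifold {
  mf_cs :> charted_space 'rV[R]_n;
  mf_hausdorff : hausdorff_space mf_cs;
  mf_second_countable : @second_countable mf_cs;
  mf_compatible : forall x y : mf_cs,
    smooth_on (in_charts_dom setT (@id mf_cs) x y) (in_charts (@id mf_cs) x y) }.

(** * Lie groups and models *)

Record lie_group (R : realType) (n : nat) := LieGroup {
  lg_manifold :> manifold R n;
  lg_one : lg_manifold;
  lg_inv : lg_manifold -> lg_manifold;
  lg_mul : lg_manifold -> lg_manifold -> lg_manifold;
  lg_mulA : associative lg_mul;
  lg_mul1g : left_id lg_one lg_mul;
  lg_mulVg : left_inverse lg_one lg_inv lg_mul;
  lg_mul_smooth : @smooth_map R _ _ (prod_cs lg_manifold lg_manifold) lg_manifold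
    (fun x => lg_mul x.1 x.2);
  lg_inv_smooth : smooth_map lg_inv }.

Section LieGroup.
Context {R : realType} {n : nat} (G : lie_group R n).

(* The Lie algebra T_e G is 'rV[R]_n, through the preferred chart at e. *)
Definition maurer_cartan (x : G) : 'rV[R]_n -> 'rV[R]_n :=
  differential (lg_mul (lg_inv x)) x.

Definition Ad (x : G) : 'rV[R]_n -> 'rV[R]_n :=
  differential (fun y => lg_mul (lg_mul x y) (lg_inv x)) (lg_one G).

Record closed_subgroup := ClosedSubgroup {
  sg_set :> G -> Prop;
  sg_one : sg_set (lg_one G);
  sg_mul : forall x y, sg_set x -> sg_set y -> sg_set (lg_mul x y);
  sg_inv : forall x, sg_set x -> sg_set (lg_inv x);
  sg_closed : closed (sg_set : set G) }.

Lemma lg_mulgV (x : G) : lg_mul x (lg_inv x) = lg_one G.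
Proof.
rewrite -[LHS]lg_mul1g -{1}(lg_mulVg (lg_inv x)) -lg_mulA (lg_mulA _ x).
by rewrite lg_mulVg lg_mul1g lg_mulVg.
Qed.

Lemma lg_mulg1 (x : G) : lg_mul x (lg_one G) = x.
Proof. by rewrite -(lg_mulVg x) lg_mulA lg_mulgV lg_mul1g. Qed.

Lemma lg_invK : involutive (@lg_inv _ _ G).
Proof.
by move=> x; rewrite -[LHS]lg_mulg1 -(lg_mulVg x) lg_mulA lg_mulVg lg_mul1g.
Qed.

Lemma lg_invM (x y : G) : lg_inv (lg_mul x y) = lg_mul (lg_inv y) (lg_inv x).
Proof.
rewrite -[RHS]lg_mulg1 -(lg_mulgV (lg_mul x y)) !lg_mulA.
by rewrite -(lg_mulA (lg_inv y)) lg_mulVg lg_mulg1 lg_mulVg lg_mul1g.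
Qed.

Variable H : closed_subgroup.

Definition coset_rel : rel G := fun x y => `[< H (lg_mul (lg_inv x) y) >].

Lemma coset_rel_refl : reflexive coset_rel.
Proof. by move=> x; apply/asboolP; rewrite lg_mulVg; exact: sg_one. Qed.

Lemma coset_rel_sym : symmetric coset_rel.
Proof.
by move=> x y; apply/asboolP/asboolP => /(@sg_inv H); rewrite lg_invM lg_invK.
Qed.

Lemma coset_rel_trans : transitive coset_rel.
Proof.
move=> y x z /asboolP xy /asboolP yz; apply/asboolP.
by move: (sg_mul xy yz); rewrite lg_mulA -(lg_mulA _ y) lg_mulgV lg_mulg1.
Qed.

Definition coset_equiv : equiv_rel G :=
  EquivRel coset_rel coset_rel_refl coset_rel_sym coset_rel_trans.

(* G/H with the quotient topology *)
Definition coset_space : topologicalType :=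
  quotient_topology {eq_quot coset_equiv}%qT.

End LieGroup.

(* A model (G, H) *)
Record model (R : realType) (n : nat) := Model {
  md_group : lie_group R n;
  md_subgroup : closed_subgroup md_group;
  md_connected : connected [set: coset_space md_subgroup] }.

(** * Velocities and paths *)

Section Curves.
Context {R : realType} {E : normedModType R} (M : charted_space E).

(* difference quotient of c at t, in the preferred chart at c t *)
Definition diff_quotient (c : R -> M) (t s : R) : E :=
  (s - t)^-1 *:
    (chart_to (chart_at (c t)) (c s) - chart_to (chart_at (c t)) (c t)).

(* The derivative of c at t along the domain D of c; it is one-sided when t is
   an endpoint of the interval D. *)
Definition has_velocity (D : set R) (c : R -> M) (t : R) (v : E) : Prop :=
  diff_quotient c t s @[s --> within D t^'] --> v.

Definition velocity (D : set R) (c : R -> M) (t : R) : E :=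
  lim (diff_quotient c t s @[s --> within D t^']).

Definition smooth_curve (c : R -> M) : Prop :=
  smooth_map (M := normed_cs R^o) c.

(* There is a subdivision 0 = a_0 < .. < a_k = 1 such that c is smooth on each
   closed interval [a_i, a_(i+1)], i.e. coincides there with a smooth curve
   defined on R.  In particular c is continuous on [0, 1]. *)
Definition piecewise_smooth (c : R -> M) : Prop :=
  exists (k : nat) (a : nat -> R),
    [/\ a 0%N = 0, a k = 1 &
        forall i, (i < k)%N -> a i < a i.+1 /\
          exists2 s : R -> M, smooth_curve s &
            forall t, a i <= t <= a i.+1 -> c t = s t].

(* Path_x(M).  A path [0, 1] -> M is encoded by its extension to R that is
   constant on either side of [0, 1]; this encoding is one-to-one. *)
Record based_path (x : M) := BasedPath {
  path_fun :> R -> M;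
  path_start : path_fun 0 = x;
  path_piecewise_smooth : piecewise_smooth path_fun;
  path_clamp : forall t, path_fun t = path_fun (Num.max 0 (Num.min 1 t)) }.

Definition curve_length (gm : M -> E -> E -> R) (c : R -> M) : \bar R :=
  \int[lebesgue_measure]_(t in `[0, 1])
    (Num.sqrt (gm (c t) (velocity `[0, 1] c t) (velocity `[0, 1] c t)))%:E.

(* the distance of the Riemannian metric gm; +oo if no path joins x to y *)
Definition riem_dist (gm : M -> E -> E -> R) (x y : M) : \bar R :=
  ereal_inf [set l | exists c : R -> M,
    [/\ piecewise_smooth c, c 0 = x, c 1 = y & l = curve_length gm c]].

End Curves.

Record inner_product (R : realType) (V : lmodType R) := InnerProduct {
  ip_fun :> V -> V -> R;
  ip_linear : forall v (a : R) u w,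
    ip_fun (a *: u + w) v = a * ip_fun u v + ip_fun w v;
  ip_sym : forall u v, ip_fun u v = ip_fun v u;
  ip_gt0 : forall v, v != 0 -> 0 < ip_fun v v }.

Definition ip_norm (R : realType) (V : lmodType R) (g : inner_product V) (v : V)
    : R :=
  Num.sqrt (g v v).

(** * Cartan geometries *)

(* s is the one-parameter subgroup t |-> exp(tY) *)
Definition one_parameter_subgroup (R : realType) (n : nat) (G : lie_group R n)
    (Y : 'rV[R]_n) (s : R -> G) : Prop :=
  [/\ smooth_curve s, forall t u, s (t + u) = lg_mul (s t) (s u) &
      has_velocity setT s 0 Y].

Section Forms.
Context {R : realType} {n : nat} {E V : normedModType R} (P : charted_space E).
Variable omega : P -> E -> V.

(* omega read in the chart at x: the vector with coordinates w in that chart has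
   coordinates ['d (in_charts id x p) u w] in the preferred chart at its own
   base point p. *)
Definition smooth_form : Prop :=
  forall (x : P) (w : E),
    smooth_on (chart_cod (chart_at x))
      (fun u => let p := chart_from (chart_at x) u in
                omega p ('d (in_charts (@id P) x p) u w)).

End Forms.

Section Principal.
Context {R : realType} {n m N : nat}.
Variables (G : lie_group R n) (H : closed_subgroup G).
Variables (M : manifold R m) (P : manifold R N).

(* Smooth principal right H-bundle.  The action of H is encoded by a function on
   P x G, of which only the values on P x H are meaningful.  A local
   trivialization over U is a pair of mutually inverse smooth equivariant maps
   psi : U x H -> pr^-1(U) and (pr, tau) : pr^-1(U) -> U x H. *)
Record principal_bundle (pr : P -> M) (act : P -> G -> P) : Prop :=
    PrincipalBundle {
  pb_proj_smooth : smooth_map pr;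
  pb_act_smooth : smooth_within (M := prod_cs P G) [set q | H q.2]
    (fun q => act q.1 q.2);
  pb_act1 : forall p, act p (lg_one G) = p;
  pb_actM : forall p h k, H h -> H k -> act (act p h) k = act p (lg_mul h k);
  pb_fiber : forall p h, H h -> pr (act p h) = pr p;
  pb_trivial : forall x : M,
    exists (U : set M) (psi : M -> G -> P) (tau : P -> G),
      [/\ open U /\ U x,
          smooth_within (M := prod_cs M G) [set q | U q.1 /\ H q.2]
            (fun q => psi q.1 q.2),
          open_smooth (pr @^-1` U) tau,
          forall y h, U y -> H h ->
            [/\ pr (psi y h) = y, tau (psi y h) = h &
                forall k, H k -> act (psi y h) k = psi y (lg_mul h k)] &
          forall p, U (pr p) -> H (tau p) /\ psi (pr p) (tau p) = p] }.

End Principal.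

(* Cartan geometry of type GH over M with total space P.  The last field says
   that, for Y in the Lie algebra of H, the flow of omega^-1(Y) is
   t |-> R_exp(tY); the Lie algebra of H consists of the Y such that exp(tY)
   stays in H. *)
Record cartan_geometry (R : realType) (n m N : nat) (GH : model R n)
    (M : manifold R m) (P : manifold R N) := CartanGeometry {
  cg_proj : P -> M;
  cg_act : P -> md_group GH -> P;
  cg_form : P -> 'rV[R]_N -> 'rV[R]_n;
  cg_principal : principal_bundle (md_subgroup GH) cg_proj cg_act;
  cg_form_smooth : smooth_form cg_form;
  cg_form_linear : forall p, linear (cg_form p);
  cg_form_iso : forall p, bijective (cg_form p);
  cg_form_equivariant : forall h, md_subgroup GH h -> forall p v,
    cg_form (cg_act p h) (differential (cg_act^~ h) p v) =
    Ad (lg_inv h) (cg_form p v);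
  cg_form_flow : forall Y (s : R -> md_group GH),
    one_parameter_subgroup Y s -> (forall t, md_subgroup GH (s t)) ->
    forall p t, exists2 v,
      has_velocity setT (fun u => cg_act p (s u)) t v &
      cg_form (cg_act p (s t)) v = Y }.

(** * The first-order compact-open topology and developments *)

Section FirstOrderDist.
Context {R : realType} {E : normedModType R} {V : lmodType R}.
Variables (P : charted_space E) (omega : P -> E -> V) (g : inner_product V).

(* the omega-constant Riemannian metric *)
Definition constant_metric (p : P) (u v : E) : R := g (omega p u) (omega p v).

Definition sup_dist (c1 c2 : R -> P) : \bar R :=
  ereal_sup [set riem_dist constant_metric (c1 t) (c2 t) | t in `[0, 1]].

(* the supremum ranges over the t at which both derivatives are well defined *)
Definition sup_velocity_dist (c1 c2 : R -> P) : \bar R :=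
  ereal_sup [set r | exists (t : R) (v1 v2 : E),
    [/\ 0 <= t <= 1, has_velocity `[0, 1] c1 t v1, has_velocity `[0, 1] c2 t v2 &
        r = (ip_norm g (omega (c1 t) v1 - omega (c2 t) v2))%:E]].

Definition first_order_dist (c1 c2 : R -> P) : \bar R :=
  (sup_dist c1 c2 + sup_velocity_dist c1 c2)%E.

End FirstOrderDist.

(* Path_x(P); omega and g only select the topology put on it below, which is the
   one induced by [first_order_dist omega g]. *)
Definition path_space (R : realType) (E : normedModType R) (V : lmodType R)
    (P : charted_space E) (omega : P -> E -> V) (g : inner_product V) (x : P) :
    Type :=
  based_path x.

Section PathSpace.
Context {R : realType} {E : normedModType R} {V : lmodType R}.
Context {P : charted_space E}.
Variables (omega : P -> E -> V) (g : inner_product V) (x : P).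

Local Notation path_space := (path_space omega g x).

HB.instance Definition _ := gen_eqMixin path_space.
HB.instance Definition _ := gen_choiceMixin path_space.

Definition path_space_open (U : set path_space) : Prop :=
  forall c, U c -> exists2 e : R, 0 < e &
    forall c' : path_space, (first_order_dist omega g c c' < e%:E)%E -> U c'.

Lemma path_space_openT : path_space_open setT.
Proof. by move=> c _; exists 1. Qed.

Lemma path_space_openI : setI_closed path_space_open.
Proof.
move=> U U' oU oU' c [/oU[e e0 eU] /oU'[e' e'0 eU']].
exists (Num.min e e'); first by rewrite lt_min e0 e'0.
move=> c' cc'; split.
- by apply/eU/(lt_le_trans cc'); rewrite lee_fin ge_min lexx.
- by apply/eU'/(lt_le_trans cc'); rewrite lee_fin ge_min lexx orbT.
Qed.

Lemma path_space_open_bigU (I : Type) (f : I -> set path_space) :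
  (forall i, path_space_open (f i)) -> path_space_open (\bigcup_i f i).
Proof.
move=> of_ c [i _ fic]; have [e e0 ef] := of_ i c fic.
by exists e => // c' /ef fic'; exists i.
Qed.

HB.instance Definition _ := @isOpenTopological.Build path_space
  path_space_open path_space_openT path_space_openI path_space_open_bigU.

End PathSpace.

(* [d] is the development of [c]: it is a path in G starting at e, and
   c^*omega = d^*omega_G at every t at which both derivatives are well
   defined. *)
Definition is_development (R : realType) (n : nat) (E : normedModType R)
    (G : lie_group R n) (P : charted_space E) (omega : P -> E -> 'rV[R]_n)
    (x : P) (c : based_path x) (d : based_path (lg_one G)) : Prop :=
  forall t v w, 0 <= t <= 1 ->
    has_velocity `[0, 1] c t v -> has_velocity `[0, 1] d t w ->
    omega (c t) v = maurer_cartan (d t) w.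

(* Main.v *)
(* Write [c1], [c2] for two nearby paths and [d1], [d2] for their developments.  No
   differential equation has to be solved: for fixed [t], the curve
   [u |-> d2(u) d1(u)^-1 d1(t)], [0 <= u <= t], joins [d1(t)] to [d2(t)], and
   [omega_G] maps its velocity to [Ad_a (omega_G(d2'(u)) - omega_G(d1'(u)))] with
   [a = d1(t)^-1 d1(u)].  The argument of [Ad_a] is [omega(c2'(u)) - omega(c1'(u))],
   and [a] stays in a compact set that depends on [d1] only.  Hence the length of
   the curve, and so the distance from [d1(t)] to [d2(t)], is at most a constant
   depending on [d1] times the first-order distance of [c1] and [c2]. *)

(* Velocities are read in the chart at the moving point, and these charts need not vary
   continuously. Every derivative is therefore carried to [e]: [logder s t] differentiates
   [u |-> s(t)^-1 s(u)] in the one chart at [e]. It is the value of the Maurer-Cartan form on the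
   velocity of [s], and it is continuous in [t], being a partial derivative of a smooth function of
   two variables.

   The order of the factors in the joining curve matters. With [d1(u)^-1] next to [d2(u)], the
   increments of both curves meet in a product [p q^-1] near [e], whose differential is a
   difference, while the conjugating element contains [d1] only; a bound involving [d2] could not be
   fixed before [c2].

   The four paths have different breakpoints, and the development equation speaks only of existing
   velocities. Continuity of [logder] on each smooth piece extends the estimates to its endpoints,
   and the length integral ignores finitely many points.

   The constant is [C2 (K + 1) C1]: [C1] and [C2] compare the two inner products with the norm of
   the Lie algebra, [K] bounds [Ad_a]. *)
Require Import Defs.
From HB Require Import structures.
From mathcomp Require Import all_boot all_order all_algebra lra.
From mathcomp Require Import all_classical all_reals all_analysis.
Import Order.TTheory GRing.Theory Num.Theory.
Import numFieldNormedType.Exports HBNNSimple.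
Local Open Scope classical_set_scope.
Local Open Scope ring_scope.

Set Implicit Arguments.
Unset Strict Implicit.
Unset Printing Implicit Defensive.

(** * Calculus of smooth maps between normed spaces *)

Section SmoothCalculus.
Context {R : realType}.
Implicit Types E F K : normedModType R.

(** [g - f] vanishes near [x], hence has differential zero there, and [g = f + (g - f)]. *)
Lemma near_eq_differentiable E F (f g : E -> F) (x : E) :
  {near x, f =1 g} -> differentiable f x -> differentiable g x.
Proof.
move=> fg df.
have -> : g = f + (g - f) by apply/funext => y; rewrite /= !fctE addrC subrK.
apply: differentiableD => //.
have h0 : (g - f) \o shift x = cst ((g - f) x) + (\0 : {linear E -> F}) +o_ 0 id.
  apply/eqaddoP => _/posnumP[e].
  have : \forall y \near 0, f (y + x) = g (y + x).
    move: fg; rewrite (near_shift 0) /= => fg.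
    by apply: filterS fg => z /=; rewrite subr0.
  apply: filterS => z fgz; rewrite /= !fctE /= (nbhs_singleton fg) fgz.
  by rewrite !subrr !(subr0, addr0) normr0 mulr_ge0.
have d0 : 'd (g - f) x = (\0 : {linear E -> F}) :> (E -> F).
  by apply: diff_unique h0; exact: cst_continuous.
by apply/diff_locallyP; rewrite d0; split => //; exact: cst_continuous.
Qed.

Lemma differentiable_scale E F (p : E -> R^o) (q : E -> F) (x : E) :
  differentiable p x -> differentiable q x ->
  differentiable (fun y => p y *: q y) x /\
  forall v, 'd (fun y => p y *: q y) x v = p x *: 'd q x v + 'd p x v *: q x.
Proof.
move=> dp dq.
have bil : bilinear_for (GRing.Scale.Law.clone _ _ *:%R _)
    (GRing.Scale.Law.clone _ _ *:%R _) (fun (a : R^o) (u : F) => a *: u).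
  split=> [u'|u] a y z /=; first by rewrite scalerDl scalerA.
  by rewrite scalerDr !scalerA mulrC.
pose sb := bilinear_isBilinear.Build R R^o F F _ _ _ bil.
pose s : {bilinear R^o -> F -> F} := HB.pack (fun (a : R^o) (u : F) => a *: u) sb.
have sc : continuous (fun z : R^o * F => s z.1 z.2) by exact: scale_continuous.
have dpq := differentiable_pair dp dq.
have -> : (fun y => p y *: q y) =
  (fun z => s z.1 z.2) \o (fun y => (p y, q y)) by [].
split; first by apply: differentiable_comp => //; exact: differentiable_bilin.
move=> v; rewrite diff_comp //; last exact: differentiable_bilin.
transitivity ((fun z : R^o * F => s (p x) z.2 + s z.1 (q x))
    ('d (fun y => (p y, q y)) x v)); last by rewrite diff_pair.
have ds := diff_bilin (p x, q x) sc.
exact: (congr1 (fun h => h ('d (fun y => (p y, q y)) x v)) ds).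
Qed.

Lemma iter_derive_rcons E F (vs : seq E) (v : E) (f : E -> F) :
  iter_derive (rcons vs v) f = iter_derive vs (fun x => 'D_v f x).
Proof. by rewrite /iter_derive foldr_rcons. Qed.

(* Off by one: [ck k A f] says that [f] is [k + 1] times differentiable on [A]. *)
Fixpoint ck E F (k : nat) (A : set E) (f : E -> F) : Prop :=
  (forall x, A x -> differentiable f x) /\
  (if k is k'.+1 then forall v, ck k' A (fun x => 'D_v f x) else True).

Lemma ck_differentiable E F k (A : set E) (f : E -> F) x :
  ck k A f -> A x -> differentiable f x.
Proof. by case: k => [|k] [+ _]; apply. Qed.

Lemma smooth_on_derive E F (A : set E) (f : E -> F) v :
  smooth_on A f -> smooth_on A (fun x => 'D_v f x).
Proof. by move=> sf vs x Ax; rewrite -iter_derive_rcons; exact: sf. Qed.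

(** A finite order gives the closure properties below an induction: differentiating a product or a
    composite mixes functions with their derivatives, and all of these are [ck] of the order below.
    [ck] strips the derivative that is applied first, the last entry of [vs]; hence the induction on
    lists from the right. *)
Lemma smooth_onP E F (A : set E) (f : E -> F) :
  smooth_on A f <-> forall k, ck k A f.
Proof.
split=> [sf k|].
  elim: k f sf => [|k IH] f sf; first by split=> // x Ax; exact: (sf [::]).
  split=> [x Ax|v]; first exact: (sf [::]).
  by apply: IH; exact: smooth_on_derive.
move=> ckf vs; elim/last_ind: vs f ckf => [|vs v IH] f ckf x Ax.
  exact: ck_differentiable (ckf 0%N) Ax.
rewrite iter_derive_rcons; apply: IH Ax => k; exact: (ckf k.+1).2.
Qed.

Lemma ck_ext E F k (A : set E) (f g : E -> F) :
  open A -> {in A, f =1 g} -> ck k A f -> ck k A g.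
Proof.
move=> oA; have nearA (f' g' : E -> F) x :
    {in A, f' =1 g'} -> A x -> {near x, f' =1 g'}.
  move=> fg Ax; have : \forall y \near x, A y by exact: open_nbhs_nbhs.
  by apply: filterS => y Ay; apply: fg; rewrite inE.
elim: k f g => [|k IH] f g fg [df ckf]; split=> //.
- by move=> x Ax; apply: near_eq_differentiable (df _ Ax); exact: nearA.
- by move=> x Ax; apply: near_eq_differentiable (df _ Ax); exact: nearA.
- move=> v; apply: IH (ckf v) => x; rewrite inE => Ax.
  by apply: near_eq_derive; exact: nearA.
Qed.

Lemma ck_le E F k (A : set E) (f : E -> F) : ck k.+1 A f -> ck k A f.
Proof.
elim: k f => [|k IH] f [df ckf]; split=> //.
by move=> v; apply: IH; exact: ckf.
Qed.

Lemma ck_cst E F k (A : set E) (a : F) : ck k A (fun _ : E => a).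
Proof.
elim: k a => [|k IH] a; split=> //; try by move=> x _; exact: differentiable_cst.
move=> v.
have -> : (fun x => 'D_v (fun=> a) x) = (fun=> 0 : F).
  by apply/funext => x; exact: derive_cst.
exact: IH.
Qed.

Lemma ck_add E F k (A : set E) (f g : E -> F) :
  open A -> ck k A f -> ck k A g -> ck k A (fun x => f x + g x).
Proof.
move=> oA; elim: k f g => [|k IH] f g cf cg; split=> //.
- by move=> x Ax; apply: differentiableD; [exact: cf.1|exact: cg.1].
- by move=> x Ax; apply: differentiableD; [exact: cf.1|exact: cg.1].
- move=> v; apply: ck_ext oA _ (IH _ _ (cf.2 v) (cg.2 v)) => x.
  rewrite inE => Ax; rewrite -deriveD //; apply: diff_derivable.
    exact: cf.1.
  exact: cg.1.
Qed.

Lemma ck_sum E F k (A : set E) n (f : 'I_n -> E -> F) :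
  open A -> (forall i, ck k A (f i)) -> ck k A (fun x => \sum_(i < n) f i x).
Proof.
move=> oA; elim: n f => [|n IH] f cf.
  have -> : (fun x => \sum_(i < 0) f i x) = fun=> 0.
    by apply/funext => x; rewrite big_ord0.
  exact: ck_cst.
have -> : (fun x => \sum_(i < n.+1) f i x) =
    fun x => f ord0 x + (\sum_(i < n) f (lift ord0 i) x).
  by apply/funext => x; rewrite big_ord_recl.
by apply: ck_add => //; exact: (IH (fun i => f (lift ord0 i))).
Qed.

Lemma ck_scale E F k (A : set E) (p : E -> R^o) (q : E -> F) :
  open A -> ck k A p -> ck k A q -> ck k A (fun x => p x *: q x).
Proof.
move=> oA; elim: k p q => [|k IH] p q cp cq; split=> //.
- by move=> x Ax; case: (differentiable_scale (cp.1 _ Ax) (cq.1 _ Ax)).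
- by move=> x Ax; case: (differentiable_scale (cp.1 _ Ax) (cq.1 _ Ax)).
- move=> v; have := ck_add oA (IH _ _ (ck_le cp) (cq.2 v))
    (IH _ _ (cp.2 v) (ck_le cq)).
  apply: ck_ext oA _ => x; rewrite inE => Ax.
  have [d dE] := differentiable_scale (cp.1 _ Ax) (cq.1 _ Ax).
  by rewrite [in RHS]deriveE // dE !deriveE //; [exact: cp.1|exact: cq.1].
Qed.

Lemma ck_linear E F K k (A : set E) (f : E -> F) (phi : {linear F -> K}) :
  open A -> continuous phi -> ck k A f -> ck k A (fun x => phi (f x)).
Proof.
move=> oA cphi; have dphi y : differentiable phi y.
  exact: linear_differentiable.
have dc f' x : differentiable f' x -> differentiable (fun y : E => phi (f' y)) x.
  by move=> d; exact: (@differentiable_comp _ _ _ _ f' phi).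
elim: k f => [|k IH] f cf; split=> //.
- by move=> x Ax; apply: dc; exact: cf.1.
- by move=> x Ax; apply: dc; exact: cf.1.
- move=> v; apply: ck_ext oA _ (IH _ (cf.2 v)) => x; rewrite inE => Ax.
  have df := cf.1 _ Ax; rewrite !deriveE //; last exact: dc.
  transitivity ('d (phi \o f) x v) => //.
  by rewrite (@diff_comp _ _ _ _ f phi) //= diff_lin.
Qed.

(* Finite-dimensionality, as a basis together with continuous coordinates. *)
Definition has_coords F := exists (n : nat) (b : 'I_n -> F)
  (phi : 'I_n -> {linear F -> R^o}),
  (forall i, continuous (phi i)) /\ forall x, x = \sum_(i < n) phi i x *: b i.

(** The chain rule is expanded in the basis: the derivative of the composite is the sum of
    [phi i ('D_v f x) *: 'D_(b i) g (f x)]. Only derivatives of [g] in constant directions occur, so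
    the induction hypothesis applies to them. *)
Lemma ck_comp E F K k (A : set E) (B : set F) (f : E -> F) (g : F -> K) :
  has_coords F -> open A -> (forall x, A x -> B (f x)) ->
  ck k A f -> smooth_on B g -> ck k A (fun x => g (f x)).
Proof.
move=> [n [b [phi [cphi bphi]]]] oA AB.
have dc g' x : ck 0 A f -> smooth_on B g' -> A x ->
    differentiable (fun y => g' (f y) : K) x.
  move=> cf sg Ax; apply: (@differentiable_comp _ _ _ _ f g').
    exact: cf.1.
  exact: (sg [::] _ (AB _ Ax)).
have ck0 k' : ck k' A f -> ck 0 A f by case: k' => [|k'] [].
elim: k g => [|k IH] g cf sg; split=> //.
- by move=> x Ax; apply: dc => //; exact: ck0 cf.
- by move=> x Ax; apply: dc => //; exact: ck0 cf.
- move=> v.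
  have cks : ck k A (fun x => \sum_(i < n)
      phi i ('D_v f x) *: 'D_(b i) g (f x)).
    apply: ck_sum => // i; apply: ck_scale => //.
      by apply: ck_linear => //; exact: cf.2.
    by apply: (IH (fun y => 'D_(b i) g y) (ck_le cf)); exact: smooth_on_derive.
  apply: ck_ext oA _ cks => x; rewrite inE => Ax.
  have df : differentiable f x by exact: cf.1.
  have dg : differentiable g (f x) by exact: (sg [::] _ (AB _ Ax)).
  rewrite [in RHS]deriveE; last by apply: dc => //; exact: ck0 cf.
  transitivity ('d (g \o f) x v) => //.
  rewrite (@diff_comp _ _ _ _ f g) //=.
  rewrite -(deriveE v df) [in RHS](bphi ('D_v f x)).
  rewrite [RHS]linear_sum.
  by apply: eq_bigr => i _; rewrite (deriveE (b i) dg) linearZ.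
Qed.

Lemma smooth_on_comp E F K (A : set E) (B : set F) (f : E -> F) (g : F -> K) :
  has_coords F -> open A -> (forall x, A x -> B (f x)) ->
  smooth_on A f -> smooth_on B g -> smooth_on A (fun x => g (f x)).
Proof.
move=> hF oA AB /smooth_onP cf sg; apply/smooth_onP => k.
exact: ck_comp hF oA AB (cf k) sg.
Qed.

Lemma smooth_on_ext E F (A : set E) (f g : E -> F) :
  open A -> {in A, f =1 g} -> smooth_on A f -> smooth_on A g.
Proof.
by move=> oA fg /smooth_onP cf; apply/smooth_onP => k; exact: ck_ext fg (cf k).
Qed.

Lemma smooth_on_cst E F (A : set E) (a : F) : smooth_on A (fun=> a).
Proof. by apply/smooth_onP => k; exact: ck_cst. Qed.

Lemma smooth_on_linear E F (A : set E) (phi : {linear E -> F}) :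
  continuous phi -> smooth_on A phi.
Proof.
move=> cphi; have dphi x : differentiable phi x by exact: linear_differentiable.
apply/smooth_onP => -[|k]; split=> // v.
have -> : (fun x => 'D_v phi x) = fun=> phi v.
  by apply/funext => x; rewrite deriveE // diff_lin.
exact: ck_cst.
Qed.

Lemma ck_pair E F K k (A : set E) (f : E -> F) (g : E -> K) :
  open A -> ck k A f -> ck k A g -> ck k A (fun x => (f x, g x)).
Proof.
move=> oA; elim: k f g => [|k IH] f g cf cg; split=> //.
- by move=> x Ax; apply: differentiable_pair; [exact: cf.1|exact: cg.1].
- by move=> x Ax; apply: differentiable_pair; [exact: cf.1|exact: cg.1].
- move=> v; apply: ck_ext oA _ (IH _ _ (cf.2 v) (cg.2 v)) => x.
  rewrite inE => Ax; have df := cf.1 _ Ax; have dg := cg.1 _ Ax.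
  by rewrite !deriveE ?diff_pair //; exact: differentiable_pair.
Qed.

Lemma smooth_on_pair E F K (A : set E) (f : E -> F) (g : E -> K) :
  open A -> smooth_on A f -> smooth_on A g -> smooth_on A (fun x => (f x, g x)).
Proof.
move=> oA /smooth_onP cf /smooth_onP cg; apply/smooth_onP => k.
exact: ck_pair.
Qed.

Lemma has_coords_reg : has_coords R^o.
Proof.
exists 1%N, (fun=> 1), (fun=> idfun); split=> [i x|x]; first exact: cvg_id.
by rewrite big_ord1 /= [RHS]mulr1.
Qed.

Lemma has_coords_rV n : has_coords 'rV[R]_n.
Proof.
have lin (i : 'I_n) : linear (fun M : 'rV[R]_n => M ord0 i : R^o).
  by move=> a u v; rewrite !mxE.
pose phi i : {linear 'rV[R]_n -> R^o} :=
  HB.pack (fun M : 'rV[R]_n => M ord0 i : R^o)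
    (GRing.isLinear.Build _ _ _ _ _ (lin i)).
exists n, (fun i => delta_mx ord0 i), phi; split=> [i|x].
  exact: coord_continuous.
exact: row_sum_delta.
Qed.

Lemma has_coords_prod E F : has_coords E -> has_coords F -> has_coords (E * F)%type.
Proof.
move=> [n [b [phi [cphi bphi]]]] [m [c [psi [cpsi cpsiE]]]].
pose p1 i : {linear (E * F)%type -> R^o} := phi i \o fst.
pose p2 i : {linear (E * F)%type -> R^o} := psi i \o snd.
pose q (j : 'I_(n + m)) := match fintype.split j with inl i => p1 i | inr i => p2 i end.
pose d (j : 'I_(n + m)) : (E * F)%type :=
  match fintype.split j with inl i => (b i, 0) | inr i => (0, c i) end.
exists (n + m)%N, d, q; split=> [j|[x y]].
  rewrite /q; case: (fintype.split j) => i z.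
    by apply: (continuous_comp (f := fst)); [exact: cvg_fst|exact: cphi].
  by apply: (continuous_comp (f := snd)); [exact: cvg_snd|exact: cpsi].
rewrite big_split_ord /= (eq_bigr (fun i => (phi i x *: b i, 0))); last first.
  move=> i _; rewrite /q /d -[lshift _ _]/(unsplit (inl i)) unsplitK /=.
  by congr (_, _); rewrite scaler0.
rewrite [X in _ + X](eq_bigr (fun i => (0, psi i y *: c i))); last first.
  move=> i _; rewrite /q /d -[rshift _ _]/(unsplit (inr i)) unsplitK /=.
  by congr (_, _); rewrite scaler0.
have s1 : \sum_(i < n) (phi i x *: b i, 0 : F) = (x, 0).
  rewrite [in RHS](bphi x); elim/big_rec2: _ => // i u v _ ->.
  by congr (_, _); rewrite addr0.
have s2 : \sum_(i < m) (0 : E, psi i y *: c i) = (0, y).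
  rewrite [in RHS](cpsiE y); elim/big_rec2: _ => // i u v _ ->.
  by congr (_, _); rewrite addr0.
by rewrite s1 s2; congr (_, _); rewrite ?addr0 ?add0r.
Qed.

End SmoothCalculus.

(** * Smooth maps between charted spaces *)

Section SmoothMapTheory.
Context {R : realType}.
Implicit Types E F L : normedModType R.

Lemma smooth_map_continuous E F (M : charted_space E) (N : charted_space F)
  (f : M -> N) : smooth_map f -> continuous f.
Proof. by move=> [cf _] x; exact: cf. Qed.

Lemma open_in_charts_dom E F (M : charted_space E) (N : charted_space F)
    (f : M -> N) (x : M) (y : N) :
  continuous f -> open (in_charts_dom setT f x y).
Proof.
move=> cf; rewrite openE => u [cu _ du].
have c1 : \forall v \near u, chart_cod (chart_at x) v.
  by apply: open_nbhs_nbhs; split=> //; exact: chart_cod_open.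
have c2 : \forall v \near u, chart_dom (chart_at y) (f (chart_from (chart_at x) v)).
  have cc : {for u, continuous (f \o chart_from (chart_at x))}.
    by apply: continuous_comp; [exact: chart_from_continuous|exact: cf].
  by apply: cc; apply: open_nbhs_nbhs; split=> //; exact: chart_dom_open.
by apply: filterS2 c1 c2 => v.
Qed.

(** Smoothness is tested at one point [u] at a time. Near [u] the composite factors through the
    preferred chart at the image [q], and both factors are readings over which the definition of
    smoothness already quantifies. *)
Lemma smooth_map_comp E F L (M : charted_space E) (N : charted_space F)
    (Q : charted_space L) (f : M -> N) (g : N -> Q) :
  has_coords F -> smooth_map f -> smooth_map g -> smooth_map (fun x => g (f x)).
Proof.
move=> hF sf sg; have cf := smooth_map_continuous sf.
have cg := smooth_map_continuous sg.
have cgf : continuous (fun x => g (f x)).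
  by move=> x; apply: (@continuous_comp _ _ _ f g); [exact: cf|exact: cg].
split=> [x _|x y vs u Au]; first exact: cgf.
have [cu _ du] := Au; pose q := f (chart_from (chart_at x) u).
pose A := in_charts_dom setT f x q `&` in_charts_dom setT (fun x => g (f x)) x y.
have oA : open A by apply: openI; exact: open_in_charts_dom.
have Aq : A u by split=> //; split=> //; exact: mem_chart_at.
have AB w : A w -> in_charts_dom setT g q y (in_charts f x q w).
  move=> [[cw _ dw] [_ _ dgw]]; split=> //; first exact: chart_to_cod.
  by rewrite /in_charts /= chart_toK.
have := smooth_on_comp hF oA AB _ (sg.2 q y).
have sfA : smooth_on A (in_charts f x q).
  by move=> ws w [Aw _]; exact: sf.2.
move=> /(_ sfA) /(smooth_on_ext oA) s; apply: (s) => // w.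
by rewrite inE => -[[cw _ dw] _]; rewrite /in_charts /= chart_toK.
Qed.

Lemma smooth_map_pair E F L (M : charted_space E) (N : charted_space F)
    (Q : charted_space L) (f : M -> N) (g : M -> Q) :
  smooth_map f -> smooth_map g ->
  smooth_map (N := prod_cs N Q) (fun x => (f x, g x)).
Proof.
move=> sf sg; have cf := smooth_map_continuous sf.
have cg := smooth_map_continuous sg.
split=> [x _|x [y z]]; first by apply: cvg_pair; [exact: cf|exact: cg].
have s : smooth_on
    (in_charts_dom setT f x y `&` in_charts_dom setT g x z)
    (fun u => (in_charts f x y u, in_charts g x z u)).
  apply: smooth_on_pair; first by apply: openI; exact: open_in_charts_dom.
    by move=> vs u [Au _]; exact: sf.2.
  by move=> vs u [_ Au]; exact: sg.2.
by move=> vs u [cu _ [/= du1 du2]]; apply: (s vs u).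
Qed.

Lemma smooth_map_cst E F (M : charted_space E) (N : charted_space F) (y : N) :
  smooth_map (fun _ : M => y).
Proof.
split=> [x _|x z]; first exact: cst_continuous.
exact: smooth_on_cst.
Qed.

(** In charts, [fst] is a linear projection followed by the change of charts from [x1] to [y]. The
    hypothesis on [@id M] is the compatibility of the atlas, which [charted_space] does not
    include. *)
Lemma smooth_map_fst E F (M : charted_space E) (N : charted_space F) :
  has_coords E -> smooth_map (@id M) -> smooth_map (M := prod_cs M N) fst.
Proof.
move=> hE sM; split=> [x _|[x1 x2] y]; first exact: cvg_fst.
have cfst : continuous (@fst E F) by move=> x; exact: cvg_fst.
have oA : open (in_charts_dom setT (M := prod_cs M N) fst (x1, x2) y).
  by apply: open_in_charts_dom => x; exact: cvg_fst.
have sfst := smooth_on_linear (A := in_charts_dom setT (M := prod_cs M N) fst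
  (x1, x2) y) cfst.
apply: (smooth_on_comp (B := in_charts_dom setT (@id M) x1 y)
  (g := in_charts (@id M) x1 y) hE oA _ sfst).
  by move=> u [cu _ du]; split; [exact: (cu : (_ `*` _) u).1| |exact: du].
exact: sM.2.
Qed.

Lemma smooth_map_snd E F (M : charted_space E) (N : charted_space F) :
  has_coords F -> smooth_map (@id N) -> smooth_map (M := prod_cs M N) snd.
Proof.
move=> hF sN; split=> [x _|[x1 x2] y]; first exact: cvg_snd.
have csnd : continuous (@snd E F) by move=> x; exact: cvg_snd.
have oA : open (in_charts_dom setT (M := prod_cs M N) snd (x1, x2) y).
  by apply: open_in_charts_dom => x; exact: cvg_snd.
have ssnd := smooth_on_linear (A := in_charts_dom setT (M := prod_cs M N) snd
  (x1, x2) y) csnd.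
apply: (smooth_on_comp (B := in_charts_dom setT (@id N) x2 y)
  (g := in_charts (@id N) x2 y) hF oA _ ssnd).
  by move=> u [cu _ du]; split; [exact: (cu : (_ `*` _) u).2| |exact: du].
exact: sN.2.
Qed.

Lemma smooth_map_id_normed E : smooth_map (@id (normed_cs E)).
Proof.
split=> [x _|x y]; first exact: cvg_id.
have cid : continuous (idfun : E -> E) by move=> z; exact: cvg_id.
exact: (smooth_on_linear (phi := idfun) cid).
Qed.

Lemma smooth_map_id_manifold n (M : manifold R n) : smooth_map (@id M).
Proof. by split=> [x _|x y]; [exact: cvg_id|exact: mf_compatible]. Qed.

Lemma smooth_map_mul n (G : lie_group R n) E (M : charted_space E)
    (f g : M -> G) :
  smooth_map f -> smooth_map g -> smooth_map (fun x => lg_mul (f x) (g x)).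
Proof.
move=> sf sg.
have hc := has_coords_prod (@has_coords_rV R n) (@has_coords_rV R n).
exact: (smooth_map_comp hc (smooth_map_pair sf sg) (@lg_mul_smooth R n G)).
Qed.

Lemma smooth_map_inv n (G : lie_group R n) E (M : charted_space E) (f : M -> G) :
  smooth_map f -> smooth_map (fun x => lg_inv (f x)).
Proof.
by move=> sf; exact: (smooth_map_comp (@has_coords_rV R n) sf (@lg_inv_smooth _ _ G)).
Qed.

Lemma smooth_map_differentiable E F (M : charted_space E) (N : charted_space F)
    (f : M -> N) (x : M) (y : N) (u : E) :
  smooth_map f -> in_charts_dom setT f x y u ->
  differentiable (in_charts f x y) u.
Proof. by move=> sf; exact: (sf.2 x y [::]). Qed.

Lemma mem_in_charts_dom E F (M : charted_space E) (N : charted_space F)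
    (f : M -> N) (x : M) (y : N) :
  f x = y -> in_charts_dom setT f x y (chart_to (chart_at x) x).
Proof.
move=> fxy; split=> //; first by apply: chart_to_cod; exact: mem_chart_at.
by rewrite chart_toK ?fxy; exact: mem_chart_at.
Qed.

End SmoothMapTheory.

(** * The chain rule for difference quotients along a filter *)

Section DifferenceQuotients.
Context {R : realType}.
Implicit Types E F L : normedModType R.

(** The remainder [h (y s) - h u - 'd h u (y s - u)] is small compared with [y s - u], and
    [(y s - u) / r s] stays bounded because it converges. A general filter covers both two-sided
    derivatives and those along an interval. *)
Lemma cvg_diff_quotient E F (FF : set_system R) {FFF : Filter FF} (r : R -> R)
    (y : R -> E) (h : E -> F) (u v : E) :
  differentiable h u -> r @ FF --> 0 -> (\forall s \near FF, r s != 0) ->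
  (fun s => (r s)^-1 *: (y s - u)) @ FF --> v ->
  (fun s => (r s)^-1 *: (h (y s) - h u)) @ FF --> 'd h u v.
Proof.
move=> dh r0 rn0 qv; set q := fun s => _ in qv.
have k0 : (fun s => y s - u) @ FF --> 0.
  rewrite -(scale0r v); apply: cvg_trans (cvgZ r0 qv); apply: near_eq_cvg.
  by apply: filterS rn0 => s rs; rewrite /q scalerA divff // scale1r.
have [dhc /eqaddoP ho] := (diff_locallyP _ _).1 dh.
have dq : 'd h u (q s) @[s --> FF] --> 'd h u v by apply: cvg_comp qv (dhc v).
rewrite -[X in _ --> X]addr0.
pose rem s := (r s)^-1 *: (h (y s) - h u - 'd h u (y s - u)).
have rem0 : rem s @[s --> FF] --> 0.
  apply/cvgrPdist_le => e e0.
  have qb : \forall s \near FF, `|q s| <= `|v| + 1.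
    have /cvgrPdist_le /(_ 1 ltr01) := qv; apply: filterS => s vq.
    rewrite -[q s](subrK v) addrC (le_trans (ler_normD _ _)) // lerD2l.
    by rewrite distrC.
  (* The quotient is eventually bounded by [|v| + 1], positive even for [v = 0]; this share of [e]
     is what the little-o has to provide. *)
  have ev : 0 < e / (`|v| + 1) by rewrite divr_gt0 // ltr_pwDr.
  have /k0 hk := ho _ ev.
  apply: filterS3 rn0 qb hk => s rs qs; rewrite sub0r normrN /rem normrZ /=.
  rewrite !fctE /= subrK opprD addrA => hs.
  rewrite normfV ler_pdivrMl ?normr_gt0 //; apply: le_trans hs _.
  have -> : y s - u = r s *: q s by rewrite /q scalerA divff // scale1r.
  rewrite normrZ mulrCA ler_pM2l ?normr_gt0 //.
  by rewrite mulrAC ler_pdivrMr ?ltr_pwDr // ler_pM2l.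
apply: cvg_trans (cvgD dq rem0); apply: near_eq_cvg; near=> s.
by rewrite fctE /rem /q linearZ /= -scalerDr addrC subrK.
Unshelve. all: by end_near. Qed.

(** A directional derivative sees only one line, so the two functions may live on different spaces.
    This turns derivatives in one variable into partial derivatives of jointly smooth maps. *)
Lemma eq_derive E F L (f : E -> L) (g : F -> L) (a v : E) (b w : F) :
  (forall h : R, f (h *: v + a) = g (h *: w + b)) -> 'D_v f a = 'D_w g b.
Proof.
move=> fg; have fgab : f a = g b by have := fg 0; rewrite !scale0r !add0r.
rewrite /derive.
suff -> : (fun h : R => h^-1 *: ((f \o shift a) (h *: v) - f a)) =
  (fun h : R => h^-1 *: ((g \o shift b) (h *: w) - g b)) by [].
by apply/funext => h /=; rewrite fg fgab.
Qed.

Lemma dnbhs_sub (t : R) :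
  (s - t) @[s --> t^'] --> (0 : R) /\ \forall s \near t^', s - t != 0.
Proof.
split; last by apply: filterS (nbhs_dnbhs_neq t) => s; rewrite subr_eq0.
rewrite -[X in _ --> X](subrr t); apply: cvgB; last exact: cvg_cst.
by apply: cvg_trans (cvg_within _) _; exact: cvg_id.
Qed.

Lemma within_dnbhs_sub (D : set R) (t : R) :
  (s - t) @[s --> within D t^'] --> (0 : R) /\
  \forall s \near within D t^', s - t != 0.
Proof.
have [r0 rn0] := dnbhs_sub t.
by split; [apply: cvg_trans r0; apply: cvg_app; exact: cvg_within|exact: cvg_within].
Qed.

End DifferenceQuotients.

Lemma smooth_curve_differentiable (R : realType) (E : normedModType R)
    (M : charted_space E) (c : R -> M) (t : R) (y : M) :
  smooth_curve c -> c t = y ->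
  differentiable (fun u : R^o => chart_to (chart_at y) (c u)) t.
Proof.
move=> sc cty; apply: (sc.2 t y [::]).
exact: (@mem_in_charts_dom R R^o E (normed_cs R^o) M c t y cty).
Qed.

(** * Logarithmic derivatives of curves in a Lie group *)

Section LogDerivative.
Context {R : realType} {n : nat} (G : lie_group R n).
Local Notation e := (lg_one G).
Local Notation phi := (chart_to (chart_at e)).

Lemma lg_mul_continuous (T : topologicalType) (f g : T -> G) (F : set_system T)
    {FF : Filter F} (a b : G) :
  f @ F --> a -> g @ F --> b -> (fun x => lg_mul (f x) (g x)) @ F --> lg_mul a b.
Proof.
move=> fa gb; have /(_ (a, b)) mc := smooth_map_continuous (@lg_mul_smooth R n G).
exact: (cvg_comp _ _ (cvg_pair fa gb) mc).
Qed.

Lemma lg_inv_continuous : continuous (@lg_inv R n G).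
Proof. exact: smooth_map_continuous (@lg_inv_smooth R n G). Qed.

(* The logarithmic derivative [s^-1 s'], read in the preferred chart at [e]. *)
Definition logder (s : R -> G) (t : R) : 'rV[R]_n :=
  'D_1 (fun u : R^o => phi (lg_mul (lg_inv (s t)) (s u))) t.

Lemma cvg_logder (s : R -> G) (t : R) (ss : smooth_curve s) :
  (fun u => (u - t)^-1 *: (phi (lg_mul (lg_inv (s t)) (s u)) - phi e))
    @ t^' --> logder s t.
Proof.
have sf : smooth_curve (fun u => lg_mul (lg_inv (s t)) (s u)).
  by apply: smooth_map_mul => //; exact: smooth_map_cst.
have df := smooth_curve_differentiable sf (lg_mulVg (s t)).
have [r0 rn0] := dnbhs_sub t.
have q1 : (fun u => (u - t)^-1 *: ((u : R^o) - t)) @ t^' --> (1 : R^o).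
  apply: (@cvg_trans _ ((fun=> 1 : R^o) @ t^')); last exact: cvg_cst.
  by apply: near_eq_cvg; apply: filterS rn0 => u ut; rewrite /= [RHS]mulVf.
have := cvg_diff_quotient df r0 rn0 q1.
by rewrite /logder deriveE // lg_mulVg; apply.
Qed.

(** [logder s t] is the partial derivative in the second variable of [(x, y) |-> s(x)^-1 s(y)] at
    [(t, t)]. As this map sends the diagonal to [e], the single chart at [e] serves for all [t]. *)
Lemma logder_continuous (s : R -> G) : smooth_curve s -> continuous (logder s).
Proof.
move=> ss t.
pose S : charted_space R^o := normed_cs R^o.
have idS : smooth_map (@id S) by exact: smooth_map_id_normed.
have hR := @has_coords_reg R.
pose k (z : prod_cs S S) : G := lg_mul (lg_inv (s z.1)) (s z.2).
have sk : smooth_map k.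
  apply: smooth_map_mul.
    apply: smooth_map_inv.
    exact: (smooth_map_comp hR (smooth_map_fst S hR idS) ss).
  exact: (smooth_map_comp hR (smooth_map_snd S hR idS) ss).
pose kc (z : R^o * R^o) : 'rV[R]_n := phi (k z).
have dk : differentiable (fun z => 'D_(0, 1) kc z) (t, t).
  have tt := mem_in_charts_dom (f := k) (x := (t, t)) (lg_mulVg (s t)).
  exact: (sk.2 _ _ [:: (0, 1)] _ tt).
have -> : logder s = fun t => 'D_(0, 1) kc (t, t).
  apply/funext => u; apply: eq_derive => h.
  by rewrite /kc /k /= scaler0 add0r.
have cd := differentiable_continuous dk.
by apply: (cvg_comp _ _ (cvg_pair cvg_id cvg_id) cd).
Qed.

(** The chain rule for left translation carries the quotient from the chart at [c t] to the chart at
    [e]. Continuity is a separate hypothesis because charts are total functions: it keeps [c u]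
    where [chart_from] undoes [chart_to]. *)
Lemma maurer_cartan_quotient (D : set R) (c : R -> G) (t : R) (v : 'rV[R]_n) :
  c @ within D t^' --> c t -> has_velocity D c t v ->
  (fun u => (u - t)^-1 *: (phi (lg_mul (lg_inv (c t)) (c u)) - phi e))
    @ within D t^' --> maurer_cartan (c t) v.
Proof.
move=> cc hv; set x := c t in cc hv *.
have sf : smooth_map (lg_mul (lg_inv x)).
  by apply: smooth_map_mul; [exact: smooth_map_cst|exact: smooth_map_id_manifold].
have [r0 rn0] := within_dnbhs_sub D t.
rewrite /maurer_cartan /differential lg_mulVg.
have df : differentiable (in_charts (lg_mul (lg_inv x)) x e)
    (chart_to (chart_at x) x).
  apply: (smooth_map_differentiable sf).
  by apply: mem_in_charts_dom; exact: lg_mulVg.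
apply: cvg_trans (cvg_diff_quotient df r0 rn0 hv); apply: near_eq_cvg.
have cx : \forall u \near within D t^', chart_dom (chart_at x) (c u).
  apply: cc; apply: open_nbhs_nbhs; split; first exact: chart_dom_open.
  exact: mem_chart_at.
apply: filterS cx => u cu.
by rewrite /in_charts /= !chart_toK ?lg_mulVg //; exact: mem_chart_at.
Qed.

Lemma Ad_derive (a : G) (v : 'rV[R]_n) :
  Ad a v = 'D_v (in_charts (fun y => lg_mul (lg_mul a y) (lg_inv a)) e e) (phi e).
Proof.
have ae : lg_mul (lg_mul a e) (lg_inv a) = e by rewrite lg_mulg1 lg_mulgV.
rewrite /Ad /differential ae deriveE //.
apply: smooth_map_differentiable; last exact: mem_in_charts_dom.
apply: smooth_map_mul; last exact: smooth_map_cst.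
by apply: smooth_map_mul; [exact: smooth_map_cst|exact: smooth_map_id_manifold].
Qed.

(** [Ad b v] is a partial derivative at [y = e] of the smooth map [(b, y) |-> b y b^-1], read in a
    fixed chart around [(a, e)]. *)
Lemma Ad_continuous (v : 'rV[R]_n) : continuous (fun a : G => Ad a v).
Proof.
move=> a; have hV := @has_coords_rV R n; have idG := smooth_map_id_manifold G.
pose k (z : prod_cs G G) : G := lg_mul (lg_mul z.1 z.2) (lg_inv z.1).
have s1 : smooth_map (M := prod_cs G G) (fun z => z.1 : G) by exact: smooth_map_fst.
have s2 : smooth_map (M := prod_cs G G) (fun z => z.2 : G) by exact: smooth_map_snd.
have sk : smooth_map k.
  apply: smooth_map_mul; first exact: smooth_map_mul.
  exact: smooth_map_inv.
have ae (b : G) : lg_mul (lg_mul b e) (lg_inv b) = e by rewrite lg_mulg1 lg_mulgV.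
pose kc := in_charts k (a, e) e.
pose w (b : G) : 'rV[R]_n * 'rV[R]_n := (chart_to (chart_at a) b, phi e).
have dk : differentiable (fun z => 'D_(0, v) kc z) (w a).
  have aa := mem_in_charts_dom (f := k) (x := (a, e)) (ae a).
  exact: (sk.2 _ _ [:: (0, v)] _ aa).
have cw : w b @[b --> a] --> w a.
  exact: (cvg_pair (chart_to_continuous (mem_chart_at a)) (cvg_cst (phi e))).
have cd := cvg_comp _ _ cw (differentiable_continuous dk).
have AdE b : chart_dom (chart_at a) b -> Ad b v = 'D_(0, v) kc (w b).
  move=> db; rewrite Ad_derive; apply: eq_derive => h.
  by rewrite /kc /in_charts /k /w /= scaler0 add0r chart_toK.
rewrite /continuous_at AdE; last exact: mem_chart_at.
apply: cvg_trans cd; apply: near_eq_cvg.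
have : \forall b \near a, chart_dom (chart_at a) b.
  by apply: open_nbhs_nbhs; split; [exact: chart_dom_open|exact: mem_chart_at].
by apply: filterS => b db /=; rewrite AdE.
Qed.

Definition lg_div (z : prod_cs G G) : G := lg_mul z.1 (lg_inv z.2).

Lemma lg_div_differentiable :
  differentiable (in_charts lg_div (e, e) e) (phi e, phi e).
Proof.
have sk : smooth_map lg_div.
  have hV := @has_coords_rV R n; have idG := smooth_map_id_manifold G.
  apply: smooth_map_mul; first exact: smooth_map_fst.
  by apply: smooth_map_inv; exact: smooth_map_snd.
have ee : lg_div (e, e) = e by rewrite /lg_div /= lg_mulgV.
have de := mem_in_charts_dom (f := lg_div) (x := (e, e)) ee.
exact: (sk.2 _ _ [::] _ de).
Qed.

(** Two restrictions determine the differential: for second factor [e] the map is the identity, on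
    the diagonal it is constant, and [(v, w) = (v - w, 0) + (w, w)]. The differential of inversion
    is never computed by itself. *)
Lemma diff_lg_div (v w : 'rV[R]_n) :
  'd (in_charts lg_div (e, e) e) (phi e, phi e) (v, w) = v - w.
Proof.
have dh := lg_div_differentiable; set h := in_charts _ _ _ in dh *.
have cod : \forall u \near phi e, chart_cod (chart_at e) u.
  apply: open_nbhs_nbhs; split; first exact: chart_cod_open.
  by apply: chart_to_cod; exact: mem_chart_at.
have fe : chart_from (chart_at e) (phi e) = e by apply: chart_toK; exact: mem_chart_at.
have eVe : lg_inv e = e by rewrite -[RHS](lg_mulVg e) lg_mulg1.
have d1 x : 'd h (phi e, phi e) (x, 0) = x.
  rewrite -deriveE //.
  rewrite (eq_derive (g := fun u => h (u, phi e)) (b := phi e) (w := x)).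
    rewrite (@near_eq_derive _ _ _ _ id) ?derive_id //.
    apply: filterS cod => u cu.
    by rewrite /h /in_charts /lg_div /= fe eVe lg_mulg1 chart_fromK.
  by move=> r; rewrite -[_ + _]/(r *: x + phi e, r *: 0 + phi e) scaler0 add0r.
have d2 x : 'd h (phi e, phi e) (x, x) = 0.
  rewrite -deriveE //.
  rewrite (eq_derive (g := fun u => h (u, u)) (b := phi e) (w := x)) //.
  rewrite (@near_eq_derive _ _ _ _ (cst (phi e))) ?derive_cst //.
  apply: filterS cod => u cu.
  by rewrite /h /in_charts /lg_div /= lg_mulgV.
have -> : (v, w) = (v - w, 0) + (w, w).
  by congr (_, _); rewrite ?subrK ?add0r.
by rewrite linearD d1 d2 addr0.
Qed.

(* [a (p q^-1) a^-1] with [p = s1(t)^-1 s1(u)], [q = s2(t)^-1 s2(u)] and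
   [a = b^-1 s2(t)] is the increment from [t] to [u] of [s1 s2^-1 b]. *)
Lemma logder_mulV (s1 s2 : R -> G) (b : G) (t : R) :
  smooth_curve s1 -> smooth_curve s2 ->
  logder (fun u => lg_mul (lg_mul (s1 u) (lg_inv (s2 u))) b) t =
  Ad (lg_mul (lg_inv b) (s2 t)) (logder s1 t - logder s2 t).
Proof.
move=> ss1 ss2; set a := lg_mul (lg_inv b) _; set s := fun u => _.
have ss : smooth_curve s.
  apply: smooth_map_mul; last exact: smooth_map_cst.
  by apply: smooth_map_mul => //; exact: smooth_map_inv.
have [r0 rn0] := dnbhs_sub t.
pose h := in_charts lg_div (e, e) e.
have dh : differentiable h (phi e, phi e) by exact: lg_div_differentiable.
have fe : chart_from (chart_at e) (phi e) = e by apply: chart_toK; exact: mem_chart_at.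
pose p u := lg_mul (lg_inv (s1 t)) (s1 u).
pose q u := lg_mul (lg_inv (s2 t)) (s2 u).
have cpq (r : R -> G) : smooth_curve r ->
    (fun u => lg_mul (lg_inv (r t)) (r u)) @ t^' --> e.
  move=> sr; rewrite -(lg_mulVg (r t)); apply: lg_mul_continuous; first exact: cvg_cst.
  have /(_ t) ct := smooth_map_continuous sr.
  by apply: cvg_trans ct; apply: cvg_app; exact: cvg_within.
have quot : (fun u => (u - t)^-1 *: ((phi (p u), phi (q u)) - (phi e, phi e)))
    @ t^' --> (logder s1 t, logder s2 t).
  exact: (cvg_pair (cvg_logder (t := t) ss1) (cvg_logder (t := t) ss2)).
(* The chain rule is used twice, for division at [(e, e)] and then for conjugation by [a]. *)
have quot1 := cvg_diff_quotient (FFF := dnbhs_filter t) dh r0 rn0 quot.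
rewrite diff_lg_div in quot1.
have he : h (phi e, phi e) = phi e by rewrite /h /in_charts /lg_div /= fe lg_mulgV.
rewrite he in quot1.
have ae : lg_mul (lg_mul a e) (lg_inv a) = e by rewrite lg_mulg1 lg_mulgV.
pose cj y := lg_mul (lg_mul a y) (lg_inv a).
have da : differentiable (in_charts cj e e) (phi e).
  apply: smooth_map_differentiable; last exact: mem_in_charts_dom.
  apply: smooth_map_mul; last exact: smooth_map_cst.
  by apply: smooth_map_mul; [exact: smooth_map_cst|exact: smooth_map_id_manifold].
have quot2 := cvg_diff_quotient (FFF := dnbhs_filter t) da r0 rn0 quot1.
rewrite -deriveE // -Ad_derive in quot2.
suff lim2 : (fun u => (u - t)^-1 *: (phi (lg_mul (lg_inv (s t)) (s u)) - phi e))
    @ t^' --> Ad a (logder s1 t - logder s2 t).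
  exact: (cvg_unique (@norm_hausdorff _ _) (cvg_logder (t := t) ss) lim2).
apply: cvg_trans quot2; apply: near_eq_cvg.
(* Near [t] the elements [p], [q] and [p q^-1] lie in the domain of the chart at [e], where the
   chart maps cancel. *)
have dome (r : R -> G) : r @ t^' --> e ->
    \forall u \near t^', chart_dom (chart_at e) (r u).
  apply; apply: open_nbhs_nbhs; split; first exact: chart_dom_open.
  exact: mem_chart_at.
have pe := cpq _ ss1; have qe := cpq _ ss2.
have pqe : (fun u => lg_mul (p u) (lg_inv (q u))) @ t^' --> e.
  rewrite -(lg_mulgV e); apply: lg_mul_continuous => //.
  by apply: cvg_comp qe _; exact: lg_inv_continuous.
apply: filterS3 (dome _ pe) (dome _ qe) (dome _ pqe) => u pu qu pqu.
congr (_ *: (_ - _)); last first.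
  by rewrite /in_charts /= fe /cj ae.
rewrite /in_charts /h /in_charts /lg_div /= !(chart_toK pu, chart_toK qu) chart_toK //.
congr (phi _); rewrite /cj /a /s /p /q !lg_invM !lg_invK !lg_mulA.
by rewrite -(lg_mulA _ (s2 t) (lg_inv (s2 t))) lg_mulgV lg_mulg1.
Qed.

End LogDerivative.

(** * Intervals avoiding finitely many points, and a bound for integrals *)

Section Intervals.
Context {R : realType}.

(** Interior points accumulate at every point of the closed interval, endpoints included. Properness
    makes limits along this filter unique, so one-sided velocities can be compared. *)
Lemma within_itvoo_proper (a b t : R) :
  a < b -> a <= t <= b -> ProperFilter (within `]a, b[%classic t^').
Proof.
move=> ab /andP[at_ tb]; apply: Build_ProperFilter_ex => P.
rewrite /within /= => /nbhs_ballP[r /= r0 rP].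
have [u [ut uab tu]] : exists u, [/\ u != t, a < u < b & `|t - u| < r].
  have [tb'|bt] := ltP t b.
    exists (t + Num.min r (b - t) / 2).
    have m0 : 0 < Num.min r (b - t) by rewrite lt_min r0 subr_gt0.
    have mr : Num.min r (b - t) <= r by rewrite ge_min lexx.
    have mb : Num.min r (b - t) <= b - t by rewrite ge_min lexx orbT.
    split; [by apply/eqP; lra|by apply/andP; split; lra|].
    by rewrite opprD addrA subrr sub0r normrN gtr0_norm; lra.
  exists (t - Num.min r (t - a) / 2).
  have m0 : 0 < Num.min r (t - a) by rewrite lt_min r0 /=; lra.
  have mr : Num.min r (t - a) <= r by rewrite ge_min lexx.
  have mb : Num.min r (t - a) <= t - a by rewrite ge_min lexx orbT.
  split; [by apply/eqP; lra|by apply/andP; split; lra|].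
  by rewrite opprB addrC subrK gtr0_norm; lra.
by exists u; apply: rP => //=; rewrite in_itv.
Qed.

Lemma within_dnbhs_subset (D D' : set R) (t : R) :
  D `<=` D' -> within D t^' --> within D' t^'.
Proof.
move=> DD' P; rewrite /within /=; apply: (@filterS _ t^') => u h Du.
by apply: h; exact: DD'.
Qed.

Lemma within_itvcc_proper (a b t : R) :
  a < b -> a <= t <= b -> ProperFilter (within `[a, b]%classic t^').
Proof.
move=> ab tab; have pF := within_itvoo_proper ab tab; apply: Build_ProperFilter => F0.
apply: (@filter_not_empty _ _ pF); apply: within_dnbhs_subset F0.
by move=> u; rewrite /= !in_itv /= => /andP[/ltW -> /ltW ->].
Qed.

Lemma near_within_dnbhs (D : set R) (t : R) (P : set R) :
  (\forall u \near t, P u) -> \forall u \near within D t^', P u.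
Proof. by rewrite /within /=; apply: filterS. Qed.

Lemma itvcc_subset (a b a' b' : R) : a' <= a -> b <= b' ->
  `[a, b]%classic `<=` `[a', b']%classic.
Proof.
move=> aa' bb' u; rewrite /= !in_itv /= => /andP[au ub].
by rewrite (le_trans aa') ?(le_trans ub).
Qed.

(** A listed point inside the current interval cuts it, and a half containing [t] is kept. If [t] is
    itself listed, it ends up as an endpoint. *)
Lemma interval_gap (l : seq R) (t : R) : 0 <= t <= 1 ->
  exists a b, [/\ 0 <= a, a < b, b <= 1, a <= t <= b &
    forall x, x \in l -> ~~ (a < x < b)].
Proof.
move=> t01; elim: l => [|x l [a [b [a0 ab b1 /andP[at_ tb] abl]]]].
  by exists 0, 1; split.
have [/andP[ax xb]|xab] := boolP (a < x < b); last first.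
  by exists a, b; split=> //; [rewrite at_|move=> y; rewrite inE => /predU1P[->|/abl]].
have [tx|xt] := leP t x.
  exists a, x; split=> //; [by rewrite (le_trans (ltW xb))|by rewrite at_|].
  move=> y; rewrite inE => /predU1P[->|/abl]; first by rewrite ltxx andbF.
  by apply: contra => /andP[-> yx] /=; exact: lt_trans xb.
exists x, b; split=> //; [by rewrite (le_trans a0) // ltW|by rewrite tb ltW|].
move=> y; rewrite inE => /predU1P[->|/abl]; first by rewrite ltxx.
by apply: contra => /andP[xy ->]; rewrite andbT; exact: lt_trans xy.
Qed.

Lemma interval_gap_open (l : seq R) (t : R) : 0 < t < 1 -> t \notin l ->
  exists a b, [/\ 0 <= a, a < t, t < b, b <= 1 &
    forall x, x \in l -> ~~ (a < x < b)].
Proof.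
move=> /andP[t0 t1]; elim: l => [_|x l IH].
  by exists 0, 1; split.
rewrite inE negb_or => /andP[tx /IH[a [b [a0 at_ tb b1 abl]]]].
have [/andP[ax xb]|xab] := boolP (a < x < b); last first.
  by exists a, b; split=> //; move=> y; rewrite inE => /predU1P[->|/abl].
have [{}tx|xt|] := ltgtP t x; last by move/eqP; rewrite (negbTE tx).
  exists a, x; split=> //; first by rewrite (le_trans (ltW xb)).
  move=> y; rewrite inE => /predU1P[->|/abl]; first by rewrite ltxx andbF.
  by apply: contra => /andP[-> yx] /=; exact: lt_trans xb.
exists x, b; split=> //; first by rewrite (le_trans a0) // ltW.
move=> y; rewrite inE => /predU1P[->|/abl]; first by rewrite ltxx.
by apply: contra => /andP[xy ->]; rewrite andbT; exact: lt_trans xy.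
Qed.

(* No measurability of [f] is needed: the integral of a nonnegative function is
   the supremum of the integrals of the simple functions below it. *)
Lemma le_integral01_off_seq (f : R -> R) (s : seq R) (K : R) :
  0 <= K -> (forall t, 0 <= f t) ->
  (forall t, 0 <= t <= 1 -> t \notin s -> f t <= K) ->
  (\int[lebesgue_measure]_(t in `[0%R, 1%R]) (f t)%:E <= K%:E)%E.
Proof.
move=> K0 f0 fK; rewrite ge0_integralE; last by move=> t _; rewrite lee_fin.
apply: ge_ereal_sup => _ [h hf <-].
have mI : measurable (`[0%R, 1%R]%classic : set R) by exact: measurable_itv.
have h0 (t : R) : ~ `[0%R, 1%R]%classic t -> h t = 0.
  move=> nt; apply/eqP; rewrite eq_le fun_ge0 andbT -lee_fin.
  by apply: le_trans (hf t) _; rewrite patchE memNset.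
rewrite -integralT_nnsfun.
have -> : (\int[lebesgue_measure]_x (h x)%:E =
    \int[lebesgue_measure]_(x in `[0%R, 1%R]) (h x)%:E)%E.
  rewrite [RHS]integral_mkcond; apply: eq_integral => x _.
  rewrite patchE; case: ifPn => // /negP xI.
  by rewrite h0 // => xI'; apply: xI; rewrite inE.
(* The points of [s] form a null set, off which [h] is at most [K] on the interval. *)
apply: (@le_trans _ _ (\int[lebesgue_measure]_(x in `[0%R, 1%R]) (cst K%:E x))%E).
  apply: ae_ge0_le_integral => //.
  - by move=> x _; rewrite lee_fin.
  - by apply/measurable_realfun.measurable_EFinP; exact: measurable_funTS.
  have cs : countable ([set` s] : set R).
    by apply: finite_set_countable; exact: finite_seq.
  exists [set` s]; split.
  - by apply: countable_measurable => // r; exact: measurable_set1.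
  - exact: countable_lebesgue_measure0.
  - move=> x /=; apply: contra_notP => /negP xs xI.
    apply: (le_trans (hf x)); rewrite patchE mem_set // lee_fin.
    by apply: fK => //; move: xI; rewrite in_itv.
rewrite integral_cst //= lebesgue_measure_itv /= lte_fin ltr01.
by rewrite -EFinB subr0 mule1.
Qed.

End Intervals.

(** * Velocities of curves that coincide with a smooth curve on an interval *)

Section Velocities.
Context {R : realType}.

Lemma has_velocity_subset (E : normedModType R) (M : charted_space E)
    (D D' : set R) (c : R -> M) (t : R) (v : E) :
  D `<=` D' -> has_velocity D' c t v -> has_velocity D c t v.
Proof. by move=> DD'; apply: cvg_trans; apply: cvg_app; exact: within_dnbhs_subset. Qed.

Lemma smooth_curve_has_velocity (E : normedModType R) (M : charted_space E)
    (D : set R) (c s : R -> M) (a b t : R) :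
  smooth_curve s -> (forall u, a <= u <= b -> c u = s u) -> a < t < b ->
  exists v, has_velocity D c t v.
Proof.
move=> ss cs /andP[at_ tb].
have df := smooth_curve_differentiable ss (erefl (s t)).
have [r0 rn0] := within_dnbhs_sub D t.
have q1 : (fun u => (u - t)^-1 *: ((u : R^o) - t)) @ within D t^' --> (1 : R^o).
  apply: (@cvg_trans _ ((fun=> 1 : R^o) @ within D t^')); last exact: cvg_cst.
  by apply: near_eq_cvg; apply: filterS rn0 => u ut; rewrite /= [RHS]mulVf.
have ct : c t = s t by apply: cs; rewrite !ltW.
eexists; apply: cvg_trans (cvg_diff_quotient df r0 rn0 q1); apply: near_eq_cvg.
have : \forall u \near within D t^', a < u < b.
  apply: near_within_dnbhs.
  have : `]a, b[%classic t by rewrite /= in_itv /= at_.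
  by move=> /(near_in_itvoo); apply: filterS => u; rewrite /= in_itv.
apply: filterS => u /andP[au ub]; rewrite /diff_quotient ct cs ?ltW //.
Qed.

(** Along the open interval, where [c] and [s] coincide, both sides are limits of the same quotient.
    At an endpoint [t], a velocity of [c] along [D] restricts to the one-sided derivative of the
    piece. *)
Lemma maurer_cartan_logder n (G : lie_group R n) (D : set R) (c s : R -> G)
    (a b t : R) (v : 'rV[R]_n) :
  a < b -> a <= t <= b -> `[a, b]%classic `<=` D -> smooth_curve s ->
  (forall u, a <= u <= b -> c u = s u) -> has_velocity D c t v ->
  maurer_cartan (c t) v = logder s t.
Proof.
move=> ab tab abD ss cs hv.
have pF := within_itvoo_proper ab tab.
pose I := (`]a, b[%classic : set R).
have Icc : I `<=` `[a, b]%classic.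
  by move=> u; rewrite /I /= !in_itv /= => /andP[/ltW -> /ltW ->].
have nearI : \forall u \near within I t^', a <= u <= b.
  rewrite /within /=; apply: (@filterE _ t^') => u Iu.
  by have := Icc _ Iu; rewrite /= in_itv.
have ct : c t = s t by exact: cs.
have st : s u @[u --> within I t^'] --> s t.
  have /(_ t) stt := smooth_map_continuous ss.
  by apply: cvg_trans stt; apply: cvg_app => P Pt; exact: near_within_dnbhs.
have cct : c u @[u --> within I t^'] --> c t.
  rewrite ct; apply: cvg_trans st; apply: near_eq_cvg.
  by apply: filterS nearI => u /cs.
have hvI : has_velocity I c t v.
  by apply: has_velocity_subset hv => u Iu; apply: abD; exact: Icc.
have q1 := maurer_cartan_quotient cct hvI.
have q2 : (fun u => (u - t)^-1 *:
    (chart_to (chart_at (lg_one G)) (lg_mul (lg_inv (s t)) (s u)) -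
     chart_to (chart_at (lg_one G)) (lg_one G)))
    @ within I t^' --> logder s t.
  by apply: cvg_trans (cvg_logder ss); apply: cvg_app; exact: cvg_within.
have q3 : (fun u => (u - t)^-1 *:
    (chart_to (chart_at (lg_one G)) (lg_mul (lg_inv (s t)) (s u)) -
     chart_to (chart_at (lg_one G)) (lg_one G)))
    @ within I t^' --> maurer_cartan (c t) v.
  apply: cvg_trans q1; apply: near_eq_cvg.
  by apply: filterS nearI => u /cs <-; rewrite ct.
exact: (cvg_unique (@norm_hausdorff _ _) q3 q2).
Qed.

End Velocities.

(** * Piecewise smoothness in terms of a list of breakpoints *)

Section Breakpoints.
Context {R : realType} {E : normedModType R} {M : charted_space E}.
Implicit Types (c : R -> M) (l : seq R).

(** An unordered list can be enlarged freely, so concatenation gives several paths common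
    breakpoints without refining subdivisions. *)
Definition smooth_off l c : Prop := forall a b, 0 <= a -> a < b -> b <= 1 ->
  (forall x, x \in l -> ~~ (a < x < b)) ->
  exists2 s : R -> M, smooth_curve s & forall u, a <= u <= b -> c u = s u.

(** The cell of the subdivision that contains [x] also contains [y]: its right end is listed and so
    cannot lie strictly between them. *)
Lemma piecewise_smooth_off c : piecewise_smooth c -> exists l, smooth_off l c.
Proof.
move=> [k [a [a0 ak H]]]; exists [seq a i | i <- iota 0 k.+1] => x y x0 xy y1 xyl.
have find j : (j <= k)%N -> x < a j -> exists2 i, (i < j)%N & a i <= x < a i.+1.
  elim: j => [_|j IH jk xj]; first by rewrite a0 ltNge x0.
  have [xaj|ajx] := ltP x (a j); last by exists j; rewrite ?ajx.
  by have [i ij xi] := IH (ltnW jk) xaj; exists i => //; exact: ltnW.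
have [|i ik /andP[aix xai]] := find k (leqnn k).
  by rewrite ak; exact: lt_le_trans y1.
have yai : y <= a i.+1.
  rewrite leNgt; apply/negP => aiy.
  have /xyl : a i.+1 \in [seq a i | i <- iota 0 k.+1].
    by apply/mapP; exists i.+1; rewrite // mem_iota.
  by rewrite xai aiy.
have [_ [s ss cs]] := H i ik; exists s => // u /andP[xu uy].
by apply: cs; rewrite (le_trans aix) ?(le_trans uy).
Qed.

Lemma smooth_off_subset l l' c :
  {subset l <= l'} -> smooth_off l c -> smooth_off l' c.
Proof. by move=> ll' H a b a0 ab b1 abl; apply: H => // x /ll'; exact: abl. Qed.

Lemma smooth_off_piecewise l c : smooth_off l c -> piecewise_smooth c.
Proof.
move=> H.
suff P x y : 0 <= x -> x < y -> y <= 1 -> exists (k : nat) (a : nat -> R),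
    [/\ a 0%N = x, a k = y & forall i, (i < k)%N -> a i < a i.+1 /\
      exists2 s : R -> M, smooth_curve s &
        forall t, a i <= t <= a i.+1 -> c t = s t].
  by apply: P.
have {H} : forall a b, x <= a -> a < b -> b <= y ->
    (forall z, z \in l -> ~~ (a < z < b)) ->
    0 <= x -> y <= 1 ->
    exists2 s : R -> M, smooth_curve s & forall u, a <= u <= b -> c u = s u.
  move=> a b xa ab by_ abl x0 y1; apply: H => //; first exact: le_trans xa.
  exact: le_trans y1.
move=> H x0 xy y1.
have {}H a b xa ab by_ abl := H a b xa ab by_ abl x0 y1.
elim: l x y xy {x0 y1} H => [|z l IH] x y xy H.
  have [s ss cs] : exists2 s : R -> M, smooth_curve s &
    forall u, x <= u <= y -> c u = s u by apply: H.
  exists 1%N, (fun i => if i is 0%N then x else y); split=> // -[|//] _.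
  by split=> //; exists s.
have [/andP[xz zy]|xzy] := boolP (x < z < y); last first.
  apply: IH => // a b xa ab by_ abl; apply: H => // w.
  rewrite inE => /predU1P[->|/abl //]; apply: contra xzy => /andP[az zb].
  by rewrite (le_lt_trans xa) ?(lt_le_trans zb).
have [||k1 [a1 [a10 a1k H1]]] := IH x z.
- exact: xz.
- move=> a b xa ab bz abl; apply: H => //; first by rewrite (le_trans bz) // ltW.
  move=> w; rewrite inE => /predU1P[->|/abl //].
  by rewrite negb_and -!leNgt bz orbT.
have [||k2 [a2 [a20 a2k H2]]] := IH z y.
- exact: zy.
- move=> a b za ab by_ abl; apply: H => //; first by rewrite (le_trans _ za) // ltW.
  move=> w; rewrite inE => /predU1P[->|/abl //].
  by rewrite negb_and -!leNgt za.
(* The subdivisions of [[x, z]] and [[z, y]] are concatenated; at [i = k1] both formulas give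
   [z]. *)
pose a i := if (i <= k1)%N then a1 i else a2 (i - k1)%N.
have aE i : (k1 <= i)%N -> a i = a2 (i - k1)%N.
  rewrite leq_eqVlt /a => /predU1P[<-|k1i]; last by rewrite leqNgt k1i.
  by rewrite leqnn subnn a1k a20.
exists (k1 + k2)%N, a; split=> [||i ik].
- by rewrite /a leq0n.
- by rewrite aE ?leq_addr // addKn.
- have [ik1|k1i] := ltnP i k1.
    by rewrite /a ik1 (ltnW ik1); exact: H1.
  rewrite !aE ?(leqW k1i) // subSn //; apply: H2.
  by rewrite ltn_subLR.
Qed.

End Breakpoints.

(** * Comparison of norms and boundedness of the adjoint action *)

Section FiniteDimensionalBounds.
Context {R : realType} {n : nat}.

Lemma coord_norm_le (v : 'rV[R]_n) i : `|v ord0 i| <= `|v|.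
Proof.
by rewrite [leRHS]/Num.norm /= mx_normrE; apply/bigmax_geP; right => /=; exists (ord0, i).
Qed.

Lemma ip0l (g : inner_product 'rV[R]_n) w : g 0 w = 0.
Proof. by have := ip_linear g w (-1) 0 0; rewrite scaler0 addr0 mulN1r addNr. Qed.

Lemma ipZl (g : inner_product 'rV[R]_n) a v w : g (a *: v) w = a * g v w.
Proof. by rewrite -[a *: v]addr0 ip_linear ip0l addr0. Qed.

Lemma ip_sum (g : inner_product 'rV[R]_n) (v : 'rV[R]_n) :
  g v v = \sum_(i < n) \sum_(j < n)
    v ord0 i * v ord0 j * g (delta_mx ord0 i) (delta_mx ord0 j).
Proof.
have g1 (w : 'rV[R]_n) (F : 'I_n -> 'rV[R]_n) (a : 'I_n -> R) :
    g (\sum_(i < n) a i *: F i) w = \sum_(i < n) a i * g (F i) w.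
  by elim/big_rec2: _ => [|i x y _ <-]; rewrite ?ip0l // ip_linear.
rewrite {1}[v]row_sum_delta g1; apply: eq_bigr => i _.
rewrite ip_sym [X in g X _]row_sum_delta g1 mulr_sumr; apply: eq_bigr => j _.
by rewrite mulrA ip_sym.
Qed.

Lemma ip_norm_le (g : inner_product 'rV[R]_n) :
  exists2 C, 0 < C & forall v, ip_norm g v <= C * `|v|.
Proof.
pose S := \sum_(i < n) \sum_(j < n) `|g (delta_mx ord0 i) (delta_mx ord0 j)|.
have S0 : 0 <= S by apply: sumr_ge0 => i _; apply: sumr_ge0.
(* The added [1] keeps the constant positive in dimension zero. *)
exists (Num.sqrt S + 1); first by rewrite ltr_pwDr // sqrtr_ge0.
move=> v; have gv : g v v <= S * `|v| ^+ 2.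
  rewrite ip_sum /S mulr_suml; apply: ler_sum => i _.
  rewrite mulr_suml; apply: ler_sum => j _.
  rewrite mulrC (le_trans (ler_norm _)) // normrM ler_wpM2l // normrM expr2.
  by rewrite ler_pM // coord_norm_le.
rewrite /ip_norm; apply: (@le_trans _ _ (Num.sqrt S * `|v|)).
  rewrite -[X in _ * X]ger0_norm // -sqrtr_sqr -sqrtrM //.
  by rewrite ler_sqrt // mulr_ge0 // sqr_ge0.
by rewrite ler_wpM2r // lerDl.
Qed.

Lemma continuous_sum (T : topologicalType) k (f : 'I_k -> T -> R) :
  (forall i, continuous (f i)) -> continuous (fun x => \sum_(i < k) f i x).
Proof.
elim: k f => [|k IH] f cf x.
  have -> : (fun x => \sum_(i < 0) f i x) = fun=> 0.
    by apply/funext => y; rewrite big_ord0.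
  exact: cvg_cst.
have -> : (fun x => \sum_(i < k.+1) f i x) =
    fun x => f ord0 x + \sum_(i < k) f (lift ord0 i) x.
  by apply/funext => y; rewrite big_ord_recl.
by apply: cvgD; [exact: cf|exact: (IH (fun i => f (lift ord0 i)))].
Qed.

Lemma ip_continuous (g : inner_product 'rV[R]_n) :
  continuous (fun v => g v v).
Proof.
have -> : (fun v => g v v) = (fun v => \sum_(i < n) \sum_(j < n)
    v ord0 i * v ord0 j * g (delta_mx ord0 i) (delta_mx ord0 j)).
  by apply/funext => v; exact: ip_sum.
apply: continuous_sum => i; apply: continuous_sum => j v.
have c i' : (w ord0 i' : R) @[w --> v] --> v ord0 i' by exact: coord_continuous.
exact: (cvgM (cvgM (c i) (c j)) (cvg_cst _)).
Qed.

(** On the compact unit sphere [g v v] attains a minimum, positive since it is taken at some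
    [c != 0]; homogeneity extends the bound to all vectors. *)
Lemma ip_norm_ge (g : inner_product 'rV[R]_n) :
  exists2 C, 0 < C & forall v, `|v| <= C * ip_norm g v.
Proof.
pose S : set 'rV[R]_n := [set v | `|v| = 1].
have cS : compact S.
  apply: bounded_closed_compact.
    by exists 1; split=> // x x1 v /= ->; exact: ltW.
  apply: (@closed_comp _ _ (fun v : 'rV[R]_n => `|v|) [set 1 : R]).
    by move=> v _; exact: norm_continuous.
  exact: closed_eq.
(* The sphere is empty only if the space is zero. *)
have [S0|nS] := pselect (S !=set0); last first.
  exists 1 => // v; have [->|v0] := eqVneq v 0; first by rewrite normr0 mul1r sqrtr_ge0.
  exfalso; apply: nS; exists (`|v|^-1 *: v).
  by rewrite /S /= normrZ normfV normr_id mulVf // normr_eq0.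
have [c cS' cmin] := EVT_min_rV S0 cS (continuous_subspaceT (@ip_continuous g)).
rewrite inE in cS'.
have c0 : c != 0 by apply: contra_eq_neq cS' => ->; rewrite normr0 eq_sym oner_neq0.
have gc := ip_gt0 g c0.
exists (Num.sqrt (g c c))^-1; first by rewrite invr_gt0 sqrtr_gt0.
move=> v; rewrite ler_pdivlMl ?sqrtr_gt0 //.
have [->|v0] := eqVneq v 0; first by rewrite normr0 mulr0 sqrtr_ge0.
have nv : 0 < `|v| by rewrite normr_gt0.
have /cmin : `|v|^-1 *: v \in S.
  by rewrite inE /S /= normrZ normfV normr_id mulVf // gt_eqF.
rewrite ipZl ip_sym ipZl => gcv.
rewrite -[X in _ * X]ger0_norm // -sqrtr_sqr -(sqrtrM _ (ltW gc)) /ip_norm.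
rewrite ler_sqrt //.
  rewrite -ler_pdivlMr ?exprn_gt0 //; apply: le_trans gcv _.
  by rewrite mulrA -invfM -expr2 mulrC.
by apply: le_trans (ltW (ip_gt0 g v0)).
Qed.

Lemma Ad_linear_sum (G : lie_group R n) (a : G) (v : 'rV[R]_n) :
  Ad a v = \sum_(i < n) v ord0 i *: Ad a (delta_mx ord0 i).
Proof.
rewrite /Ad /differential {1}[v]row_sum_delta linear_sum.
by apply: eq_bigr => i _; rewrite linearZ.
Qed.

(** By linearity it is enough to bound the images of the basis vectors, each of which is continuous
    on the compact square. *)
Lemma Ad_bounded_curves (G : lie_group R n) (s s' : R -> G) :
  continuous s -> continuous s' ->
  exists2 K, 0 < K & forall t u, 0 <= t <= 1 -> 0 <= u <= 1 ->
    forall v, `|Ad (lg_mul (lg_inv (s t)) (s' u)) v| <= K * `|v|.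
Proof.
move=> cs cs'; pose I : set R := `[0, 1]%classic.
have bnd i : exists K, forall t u, 0 <= t <= 1 -> 0 <= u <= 1 ->
    `|Ad (lg_mul (lg_inv (s t)) (s' u)) (delta_mx ord0 i)| <= K.
  pose f (z : R * R) : R :=
    `|Ad (lg_mul (lg_inv (s z.1)) (s' z.2)) (delta_mx ord0 i)|.
  have cf : continuous f.
    move=> z.
    have c1 : lg_inv (s y.1) @[y --> z] --> lg_inv (s z.1).
      have c0 : s y.1 @[y --> z] --> s z.1.
        by apply: (@cvg_comp _ _ _ fst s) (cs z.1); exact: cvg_fst.
      by apply: (cvg_comp _ _ c0); exact: lg_inv_continuous.
    have c2 : s' y.2 @[y --> z] --> s' z.2.
      by apply: (@cvg_comp _ _ _ snd s') (cs' z.2); exact: cvg_snd.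
    have c3 := cvg_comp _ _ (lg_mul_continuous (FF := nbhs_filter z) c1 c2)
      (@Ad_continuous R n G (delta_mx ord0 i) _).
    exact: (cvg_norm c3).
  have cI : compact (I `*` I) by apply: compact_setX; exact: segment_compact.
  have I0 : I `*` I !=set0.
    by exists (0, 0); split; rewrite /I /= in_itv /= lexx ler01.
  have [z _ zmax] := compact_EVT_max I0 cI (continuous_subspaceT cf).
  exists (f z) => t u t01 u01; apply: (zmax (t, u)).
  by rewrite inE; split; rewrite /I /= in_itv.
have {bnd}[K bK] := choice bnd.
exists (\sum_(i < n) `|K i| + 1); first by rewrite ltr_pwDr // sumr_ge0.
move=> t u t01 u01 v; rewrite Ad_linear_sum.
apply: le_trans (ler_norm_sum _ _ _) _.
rewrite mulrDl mul1r; apply: ler_wpDr => //.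
rewrite mulr_suml; apply: ler_sum => i _; rewrite normrZ mulrC ler_pM //.
  by apply: le_trans (bK i t u t01 u01) _; exact: ler_norm.
exact: coord_norm_le.
Qed.

(** [t] and [u] may lie in different pieces, which is why two curves are allowed above. The smooth
    extensions of the pieces are bounded on the whole square, and the constants of all pairs are
    added. *)
Lemma Ad_bounded_piecewise (G : lie_group R n) (c : R -> G) :
  piecewise_smooth c ->
  exists2 K, 0 < K & forall t u, 0 <= t <= 1 -> 0 <= u <= 1 ->
    forall v, `|Ad (lg_mul (lg_inv (c t)) (c u)) v| <= K * `|v|.
Proof.
move=> [k [a [a0 ak H]]].
have pieces i : exists s : R -> G, (i < k)%N ->
    smooth_curve s /\ forall t, a i <= t <= a i.+1 -> c t = s t.
  have [ik|_] := ltnP i k; last by exists c.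
  by have [_ [s ss cs]] := H i ik; exists s.
have {pieces}[s sP] := choice pieces.
have find j t : (j <= k)%N -> 0 <= t -> t < a j ->
    exists2 i, (i < j)%N & a i <= t < a i.+1.
  move=> + t0; elim: j => [_|j IH jk xj]; first by rewrite a0 ltNge t0.
  have [xaj|ajx] := ltP t (a j); last by exists j; rewrite ?ajx.
  by have [i ij xi] := IH (ltnW jk) xaj; exists i => //; exact: ltnW.
have k0 : (0 < k)%N.
  by case: k ak {H sP find} => // a01; move: (@ltr01 R); rewrite -a01 a0 ltxx.
have cov t : 0 <= t <= 1 -> exists i : 'I_k, c t = s i t.
  move=> /andP[t0]; rewrite le_eqVlt -ak => /predU1P[->|/find].
    have k1 : (k.-1 < k)%N by rewrite prednK.
    exists (Ordinal k1); have [_ ->] := sP _ k1 => //=.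
    by have [/ltW] := H _ k1; rewrite prednK // lexx => -> _.
  move=> /(_ (leqnn k) t0)[i ik /andP[ait tai]].
  by exists (Ordinal ik); have [_ ->] := sP _ ik => //=; rewrite ait ltW.
have bnd (ij : 'I_k * 'I_k) : exists K, 0 < K /\
    forall t u, 0 <= t <= 1 -> 0 <= u <= 1 ->
    forall v, `|Ad (lg_mul (lg_inv (s ij.1 t)) (s ij.2 u)) v| <= K * `|v|.
  have c1 := smooth_map_continuous (sP _ (ltn_ord ij.1)).1.
  have c2 := smooth_map_continuous (sP _ (ltn_ord ij.2)).1.
  by have [K K0 HK] := Ad_bounded_curves c1 c2; exists K.
have {bnd}[K KP] := choice bnd.
exists (\sum_ij K ij + 1).
  by rewrite ltr_pwDr // sumr_ge0 // => ij _; exact: ltW (KP ij).1.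
move=> t u t01 u01 v; have [i ->] := cov t t01; have [j ->] := cov u u01.
apply: le_trans ((KP (i, j)).2 t u t01 u01 v) _; rewrite ler_wpM2r //.
rewrite (bigD1 (i, j)) //= -addrA lerDl addr_ge0 // sumr_ge0 // => ij _.
exact: ltW (KP ij).1.
Qed.

End FiniteDimensionalBounds.

(** * The distance between curves with close logarithmic derivatives *)

Section FirstOrderDistance.
Context {R : realType}.

(** [sup_dist] is nonnegative: it is at least its term at [0], an infimum of nonnegative lengths. *)
Lemma sup_velocity_dist_le (E : normedModType R) (V : lmodType R)
    (P : charted_space E) (omega : P -> E -> V) (g : inner_product V)
    (c1 c2 : R -> P) :
  (sup_velocity_dist omega g c1 c2 <= first_order_dist omega g c1 c2)%E.
Proof.
apply: leeDr.
apply: (@le_trans _ _ (riem_dist (constant_metric omega g) (c1 0) (c2 0))).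
  apply: le_ereal_inf_tmp => _ [c [_ _ _ ->]].
  by apply: integral_ge0 => t _; rewrite lee_fin sqrtr_ge0.
by apply: ereal_sup_ubound; exists 0 => //=; rewrite in_itv /= lexx ler01.
Qed.

Variables (n : nat) (G : lie_group R n) (g : inner_product 'rV[R]_n).
Variables (d d' : R -> G) (l : seq R) (B K C : R).
Hypotheses (dl : smooth_off l d) (dl' : smooth_off l d') (dd' : d 0 = d' 0).
(** The bound is put on smooth extensions over closed intervals, as [d] and [d'] may lack velocities
    at breakpoints. *)
Hypothesis logderB : forall a b (s s' : R -> G), 0 <= a -> a < b -> b <= 1 ->
  (forall x, x \in l -> ~~ (a < x < b)) -> smooth_curve s -> smooth_curve s' ->
  (forall u, a <= u <= b -> d u = s u) ->
  (forall u, a <= u <= b -> d' u = s' u) ->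
  forall u, a <= u <= b -> `|logder s u - logder s' u| <= B.
Hypothesis AdK : forall t u, 0 <= t <= 1 -> 0 <= u <= 1 ->
  forall v, `|Ad (lg_mul (lg_inv (d t)) (d u)) v| <= K * `|v|.
Hypotheses (C0 : 0 <= C) (K0 : 0 <= K) (B0 : 0 <= B).
Hypothesis gC : forall v, ip_norm g v <= C * `|v|.

Lemma sup_velocity_dist_logder :
  (sup_velocity_dist (@maurer_cartan R n G) g d d' <= (C * B)%:E)%E.
Proof.
apply: ge_ereal_sup => _ [t [v [v' [t01 dv dv' ->]]]]; rewrite lee_fin.
have [a [b [a0 ab b1 tab abl]]] := interval_gap l t01.
have [s ss ds] := dl a0 ab b1 abl; have [s' ss' ds'] := dl' a0 ab b1 abl.
have sub := itvcc_subset a0 b1.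
rewrite (maurer_cartan_logder ab tab sub ss ds dv).
rewrite (maurer_cartan_logder ab tab sub ss' ds' dv').
apply: le_trans (gC _) _; rewrite ler_wpM2l //.
exact: (logderB a0 ab b1 abl).
Qed.

(* Constant for [u >= t], which spares a reparametrization of [0, t] by [0, 1]. *)
Let joining (t u : R) : G :=
  lg_mul (lg_mul (d' (Num.min u t)) (lg_inv (d (Num.min u t)))) (d t).

(** The [min] makes [t] an extra breakpoint. An interval without breakpoints lies before [t], where
    [logder_mulV] applies with conjugating element [d(t)^-1 d(u)], or after [t], where the curve
    rests at [d' t]. *)
Let joiningE (t a b : R) :
  0 <= a -> a < b -> b <= 1 -> (forall x, x \in t :: l -> ~~ (a < x < b)) ->
  exists2 r, smooth_curve r /\ (forall u, a <= u <= b -> joining t u = r u) &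
    forall u, a <= u <= b -> 0 <= t <= 1 -> `|logder r u| <= K * B.
Proof.
move=> a0 ab b1 abl.
have {}abl' x : x \in l -> ~~ (a < x < b) by move=> xl; apply: abl; rewrite inE xl orbT.
have [bt|tb] := leP b t.
  have [s1 ss1 ds1] := dl a0 ab b1 abl'; have [s2 ss2 ds2] := dl' a0 ab b1 abl'.
  exists (fun u => lg_mul (lg_mul (s2 u) (lg_inv (s1 u))) (d t)).
    split.
      apply: smooth_map_mul; last exact: smooth_map_cst.
      by apply: smooth_map_mul => //; exact: smooth_map_inv.
    move=> u uab; have /andP[_ ub] := uab.
    by rewrite /joining min_l ?(le_trans ub) // ds1 // ds2.
  move=> u uab t01; have /andP[au ub] := uab.
  rewrite logder_mulV // -ds1 //; apply: le_trans (AdK _ _ _) _ => //.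
    by rewrite (le_trans a0) ?(le_trans ub).
  rewrite ler_wpM2l // -normrN opprB.
  exact: (logderB a0 ab b1 abl').
have ta : t <= a.
  have := abl t; rewrite inE eqxx => /(_ isT); rewrite tb andbT.
  by rewrite -leNgt.
exists (fun=> d' t).
  split; first exact: smooth_map_cst.
  move=> u /andP[au _]; rewrite /joining min_r ?(le_trans ta) //.
  by rewrite -lg_mulA lg_mulVg lg_mulg1.
move=> u _ _.
have -> : logder (fun=> d' t) u = 0 by exact: derive_cst.
rewrite normr0.
exact: mulr_ge0.
Qed.

Lemma riem_dist_logder (t : R) : 0 <= t <= 1 ->
  (riem_dist (constant_metric (@maurer_cartan R n G) g) (d t) (d' t) <=
   (C * (K * B))%:E)%E.
Proof.
move=> t01; have /andP[t0 t1] := t01.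
apply: (@le_trans _ _ (curve_length (constant_metric (@maurer_cartan R n G) g)
    (joining t))).
  apply: ereal_inf_lbound; exists (joining t); split=> //.
  - apply: (@smooth_off_piecewise _ _ _ (t :: l)) => a b a0 ab b1 abl.
    by have [r [sr jr] _] := joiningE a0 ab b1 abl; exists r.
  - by rewrite /joining min_l // dd' lg_mulgV lg_mul1g.
  - by rewrite /joining min_r // -lg_mulA lg_mulVg lg_mulg1.
(* At the breakpoints and at [t] the limit defining [velocity] may fail to exist. They are excluded
   together with [0] and [1], so that every remaining [u] is interior to a smooth piece. *)
rewrite /curve_length; apply: (@le_integral01_off_seq _ _ (0 :: 1 :: t :: l)).
- by rewrite !mulr_ge0.
- by move=> u; exact: sqrtr_ge0.
move=> u /andP[u0 u1]; rewrite !inE !negb_or => /and4P[u0' u1' ut ul].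
have uo : 0 < u < 1 by rewrite lt_neqAle eq_sym u0' u0 lt_neqAle u1' u1.
have utl : u \notin t :: l by rewrite inE negb_or ut ul.
have [a [b [a0 au ub b1 abl]]] := interval_gap_open uo utl.
have ab := lt_trans au ub.
have [r [sr jr] rB] := joiningE a0 ab b1 abl.
have uab : a < u < b by rewrite au ub.
have uab' : a <= u <= b by rewrite !ltW.
have [v hv] := smooth_curve_has_velocity `[0, 1]%classic sr jr uab.
have pF : ProperFilter (within `[0, 1]%classic u^').
  by apply: within_itvcc_proper; rewrite ?ltr01 // u0.
have vE : velocity `[0, 1]%classic (joining t) u = v.
  exact: (cvg_lim (@norm_hausdorff _ _) hv).
rewrite vE -/(ip_norm g _).
have sub := itvcc_subset a0 b1.
rewrite (maurer_cartan_logder ab uab' sub sr jr hv).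
by apply: le_trans (gC _) _; rewrite ler_wpM2l // rB.
Qed.

Lemma first_order_dist_logder :
  (first_order_dist (@maurer_cartan R n G) g d d' <=
   (C * (K * B) + C * B)%:E)%E.
Proof.
rewrite EFinD; apply: leeD; last exact: sup_velocity_dist_logder.
apply: ge_ereal_sup => _ [t t01 <-]; apply: riem_dist_logder.
by move: t01; rewrite /= in_itv.
Qed.

End FirstOrderDistance.

(* Both sides are continuous in [u], so the endpoints follow from the interior,
   where the development equation identifies them with velocities of [c] and [c']. *)
Lemma development_logder_le (R : realType) (n : nat) (E : normedModType R)
    (G : lie_group R n) (P : charted_space E) (omega : P -> E -> 'rV[R]_n)
    (x : P) (c c' : based_path x) (d d' : based_path (lg_one G))
    (g : inner_product 'rV[R]_n) (l : seq R) (C delta : R) :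
  smooth_off l c -> smooth_off l c' ->
  is_development omega c d -> is_development omega c' d' -> 0 <= C ->
  (forall v, `|v| <= C * ip_norm g v) ->
  (first_order_dist omega g c c' < delta%:E)%E ->
  forall a b (s s' : R -> G), 0 <= a -> a < b -> b <= 1 ->
    (forall x, x \in l -> ~~ (a < x < b)) -> smooth_curve s -> smooth_curve s' ->
    (forall u, a <= u <= b -> d u = s u) ->
    (forall u, a <= u <= b -> d' u = s' u) ->
    forall u, a <= u <= b -> `|logder s u - logder s' u| <= C * delta.
Proof.
move=> cl c'l cd cd' C0 gC cc' a b s s' a0 ab b1 abl ss ss' ds ds'.
have [r sr cr] := cl a b a0 ab b1 abl; have [r' sr' cr'] := c'l a b a0 ab b1 abl.
have sub := itvcc_subset a0 b1.
have inner u : a < u < b -> `|logder s u - logder s' u| <= C * delta.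
  move=> uab; have uab' : a <= u <= b by have /andP[? ?] := uab; rewrite !ltW.
  have u01 : 0 <= u <= 1 by have := sub u; rewrite /= !in_itv; exact.
  have [v hv] := smooth_curve_has_velocity `[0, 1]%classic sr cr uab.
  have [v' hv'] := smooth_curve_has_velocity `[0, 1]%classic sr' cr' uab.
  have [w hw] := smooth_curve_has_velocity `[0, 1]%classic ss ds uab.
  have [w' hw'] := smooth_curve_has_velocity `[0, 1]%classic ss' ds' uab.
  rewrite -(maurer_cartan_logder ab uab' sub ss ds hw).
  rewrite -(maurer_cartan_logder ab uab' sub ss' ds' hw').
  rewrite -(cd u v w) // -(cd' u v' w') //.
  apply: le_trans (gC _) _; rewrite ler_wpM2l // -lee_fin; apply: ltW.
  apply: le_lt_trans cc'; apply: le_trans (sup_velocity_dist_le _ _ _ _).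
  by apply: ereal_sup_ubound; exists u, v, v'.
move=> u uab; have pF := within_itvoo_proper ab uab.
pose f v := `|logder s v - logder s' v|.
have fu : f v @[v --> within `]a, b[%classic u^'] --> f u.
  have c0 : f v @[v --> u] --> f u.
    by apply: cvg_norm; apply: cvgB; exact: logder_continuous.
  by apply: cvg_trans c0; apply: cvg_app => Q Qu; exact: near_within_dnbhs.
rewrite -/(f u) -(cvg_lim (@norm_hausdorff _ _) fu).
apply: limr_le; first by apply/cvg_ex; exists (f u).
rewrite /within /=; apply: (@filterE _ u^') => v vab.
by apply: inner; move: vab; rewrite /= in_itv.
Qed.

Theorem proposition3p3 (R : realType) (n m N : nat) (GH : model R n)
    (M : manifold R m) (P : manifold R N) (C : cartan_geometry GH M P) (e : P)
    (g1 g2 : inner_product 'rV[R]_n)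
    (dev : path_space (cg_form C) g1 e ->
           path_space (@maurer_cartan R n (md_group GH)) g2
             (lg_one (md_group GH)))
    (devP : forall c : path_space (cg_form C) g1 e,
      is_development (cg_form C) c (dev c)) :
  continuous dev.
Proof.
apply/continuousP => U oU.
have {}oU : path_space_open U := oU.
suff : path_space_open (dev @^-1` U) by [].
move=> c /oU[r r0 rU].
have [C1 C10 gC1] := ip_norm_ge g1; have [C2 C20 gC2] := ip_norm_le g2.
have [K K0 AdK] := Ad_bounded_piecewise (path_piecewise_smooth (dev c)).
(* The bound of [first_order_dist_logder] is [L * delta] when [B = C1 * delta]; [L] is fixed before
   [c']. *)
pose L := C2 * (K * C1) + C2 * C1.
have L0 : 0 < L by rewrite addr_gt0 ?mulr_gt0.
have delta0 : 0 < r / 2 / L by rewrite !divr_gt0.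
(* The final estimate is not strict, so it aims at half of [r]. *)
exists (r / 2 / L) => // c' cc'; apply: rU.
have [l1 cl] := piecewise_smooth_off (path_piecewise_smooth c).
have [l2 c'l] := piecewise_smooth_off (path_piecewise_smooth c').
have [l3 dl] := piecewise_smooth_off (path_piecewise_smooth (dev c)).
have [l4 d'l] := piecewise_smooth_off (path_piecewise_smooth (dev c')).
(* The common breakpoints depend on [c'], unlike the constants above. *)
pose l := (l1 ++ l2) ++ (l3 ++ l4).
have {}cl : smooth_off l c.
  by apply: smooth_off_subset cl => x xl; rewrite !mem_cat xl.
have {}c'l : smooth_off l c'.
  by apply: smooth_off_subset c'l => x xl; rewrite !mem_cat xl !orbT.
have {}dl : smooth_off l (dev c).
  by apply: smooth_off_subset dl => x xl; rewrite !mem_cat xl !orbT.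
have {}d'l : smooth_off l (dev c').
  by apply: smooth_off_subset d'l => x xl; rewrite !mem_cat xl !orbT.
have dd' : dev c 0 = dev c' 0 by rewrite !path_start.
have B0 : 0 <= C1 * (r / 2 / L) by rewrite mulr_ge0 ?ltW.
have bnd := development_logder_le cl c'l (devP c) (devP c') (ltW C10) gC1 cc'.
apply: le_lt_trans (first_order_dist_logder dl d'l dd' bnd AdK (ltW C20)
  (ltW K0) B0 gC2) _.
have -> : C2 * (K * (C1 * (r / 2 / L))) + C2 * (C1 * (r / 2 / L)) =
    L * (r / 2 / L) by rewrite /L mulrDl !mulrA.
by rewrite mulrC divfK ?gt_eqF // lte_fin ltr_pdivrMr // ltr_pMr // ltr1n.
Qed.
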